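(* Let $n\ge2$, let $s_1,\dots,s_n$ be the canonical generators of the Cuntz algebra $\mathcal{O}_n$, let $A=\mathcal{O}_n^{\mathbb{T}}\cong M_{n^\infty}$ be the fixed-point algebra of the gauge action, and let $E:\mathcal{O}_n\to A$ be the canonical expectation onto the fixed points of the gauge action. Let $F:\mathsf{Hilb_{fd}}(\mathbb{Z})\to\mathsf{Bim_{fgp}}(A)$ be the fully faithful unitary tensor functor with $F(\mathbb{C}_0)=A$, $F(\mathbb{C}_k)=As_1^k$ and $F(\mathbb{C}_{-k})=(s_1^* )^kA$ for $k\in\mathbb{N}$, and with tensorator given by multiplication in $\mathcal{O}_n$. Then there is an expectation-preserving $*$-isomorphism of irreducible C*-discrete inclusions $$\left(A\overset{E}{\subset}\mathcal{O}_n\right)\cong\left(A\overset{E'}{\subset}A\rtimes_{r,F}\mathbb{C}[\mathbb{Z}]\right),$$ where $E'$ is the canonical expectation that maps formal sums with coefficients in $A$ to the component graded by $0\in\mathbb{Z}$.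
   Context: $\mathcal{O}_n$ is the universal C*-algebra generated by $s_1,\dots,s_n$ with $s_i^*s_j=\delta_{i=j}1$, $\sum_is_is_i^*=1$; the gauge action of $\mathbb{T}$ is $z\cdot s_j=zs_j$, and $E$ is its average against normalized Haar measure. $\mathsf{Bim_{fgp}}(A)$ consists of $A$-$A$ bimodules with a right (linear in the second variable) and a left (linear in the first variable) $A$-valued inner product making them right and left Hilbert $A$-modules, with each action adjointable for the opposite inner product. The two inner products induce equivalent norms, and each bimodule has a finite right Pimsner–Popa basis $\{u_i\}$ ($\xi=\sum_iu_i\lhd\langle u_i\mid\xi\rangle_A$) and a finite left Pimsner–Popa basis $\{v_j\}$ ($\xi=\sum_j{}_A\langle\xi,v_j\rangle\rhd v_j$). Morphisms are adjointable bimodule maps. The sub-bimodules $As_1^k$, $(s_1^* )^kA$ of $\mathcal{O}_n$ carry $\langle x\mid y\rangle_A=x^*y$ and ${}_A\langle x,y\rangle=xy^*$. A unital inclusion $A\subset B$ with faithful conditional expectation $E:B\to A$ is irreducible if $A'\cap B=\mathbb{C}1$. $\mathsf{PQN}(A\subset B)$ is the set of $b\in B$ that lie in some $A$-$A$ sub-bimodule $K\subset B$ which, with right inner product $E(x^*y)$, belongs to $\mathsf{Bim_{fgp}}(A)$; the inclusion is C*-discrete if $\mathsf{PQN}(A\subset B)$ is norm-dense in $B$. An isomorphism of inclusions is expectation-preserving if it restricts to the identification of the copies of $A$ and intertwines the expectations. $\mathsf{Hilb_{fd}}(\mathbb{Z})$ is the unitary tensor category of finite-dimensional $\mathbb{Z}$-graded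 Hilbert spaces with simple objects $\mathbb{C}_k$, $\mathbb{C}_k\otimes\mathbb{C}_\ell=\mathbb{C}_{k+\ell}$. $\mathbb{C}[\mathbb{Z}]$ is the group C*-algebra object with $\mathbb{C}[\mathbb{Z}](k)=\mathbb{C}$. The algebraic direct sum $\bigoplus_kF(\mathbb{C}_k)\otimes\mathbb{C}[\mathbb{Z}](k)=\bigoplus_kF(\mathbb{C}_k)$ is a unital $*$-algebra with product given by the tensorator of $F$, and with $\xi^*\in F(\mathbb{C}_{-k})$, for $\xi\in F(\mathbb{C}_k)$, determined by $\xi^*\cdot\eta=\langle\xi\mid\eta\rangle_A$ for $\eta\in F(\mathbb{C}_k)$. $A\rtimes_{r,F}\mathbb{C}[\mathbb{Z}]$ is its completion in the operator norm of left multiplication on the right Hilbert $A$-module direct sum of the $F(\mathbb{C}_k)$. *)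

(* Defs.v *)
From HB Require Import structures.
From mathcomp Require Import all_boot all_order all_algebra.
From mathcomp Require Import complex finmap.
From mathcomp Require Import all_classical all_reals all_analysis.
Set Implicit Arguments.
Unset Strict Implicit.
Unset Printing Implicit Defensive.
Import Order.TTheory GRing.Theory Num.Theory.
Import numFieldNormedType.Exports.
Local Open Scope classical_set_scope.
Local Open Scope ring_scope.

(* [X] with the norm [N] is complete. *)
Definition complete_for (R : numDomainType) (X : zmodType) (N : X -> R) : Prop :=
  forall u : nat -> X,
    (forall e : R, 0 < e -> exists M : nat,
       forall p q : nat, (M <= p)%N -> (M <= q)%N -> N (u p - u q) < e) ->
    exists l : X, forall e : R, 0 < e -> exists M : nat,
       forall p : nat, (M <= p)%N -> N (u p - l) < e.

(** * C*-algebras *)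

(* Complex, unital and nonzero.  The norm [cnorm] is real-valued; the normed
   modules of the library cannot be used here, as they cannot be joined with
   ring structures, and those over [R[i]] have a norm valued in [R[i]]. *)
HB.mixin Record isCStar (R : realType) A of GRing.Algebra R[i] A := {
  star : A -> A;
  cnorm : A -> R;
  starK : involutive star;
  starD : {morph star : x y / x + y};
  starZ : forall (c : R[i]) (x : A), star (c *: x) = (c^*)%R *: star x;
  starM : forall x y : A, star (x * y) = star y * star x;
  cnormD : forall x y : A, cnorm (x + y) <= cnorm x + cnorm y;
  cnormZ : forall (c : R[i]) (x : A), cnorm (c *: x) = Normc.normc c * cnorm x;
  cnorm0_eq0 : forall x : A, cnorm x = 0 -> x = 0;
  cnormM : forall x y : A, cnorm (x * y) <= cnorm x * cnorm y;
  cnorm_star : forall x : A, cnorm (star x * x) = cnorm x ^+ 2;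
  cnorm_complete : complete_for cnorm
}.

#[short(type="cstarAlgType")]
HB.structure Definition CStarAlgebra (R : realType) :=
  {A of isCStar R A & GRing.Algebra R[i] A}.

Definition dense_in (R : realType) (A : cstarAlgType R) (S : set A) : Prop :=
  forall (a : A) (e : R), 0 < e -> exists2 w, S w & cnorm (a - w) < e.

Definition positive_elt (R : realType) (A : cstarAlgType R) (a : A)
  : Prop := exists b : A, a = star b * b.

Record star_hom (R : realType) (A B : cstarAlgType R) (f : A -> B)
  : Prop := StarHom {
  star_homZD : forall (c : R[i]) x y, f (c *: x + y) = c *: f x + f y;
  star_homM : forall x y, f (x * y) = f x * f y;
  star_hom1 : f 1 = 1;
  star_hom_star : forall x, f (star x) = star (f x)
}.

Definition star_iso (R : realType) (A B : cstarAlgType R) (f : A -> B)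
  : Prop := star_hom f /\ bijective f.

(** * Hilbert bimodules *)

Record bimod_data (R : realType) (A : cstarAlgType R) := BimodData {
  bcar :> lmodType R[i];
  lact : A -> bcar -> bcar;
  ract : bcar -> A -> bcar;
  rip : bcar -> bcar -> A;
  lip : bcar -> bcar -> A
}.

Notation "a '▷' x" := (lact a x) (at level 40, left associativity).
Notation "x '◁' a" := (ract x a) (at level 40, left associativity).
Notation "'⟨' x '|' y '⟩'" := (rip x y) (at level 0, x, y at level 99).
Notation "'⟪' x ',' y '⟫'" := (lip x y) (at level 0, x, y at level 99).

Definition rnorm (R : realType) (A : cstarAlgType R)
  (X : bimod_data A) (x : X) : R := Num.sqrt (cnorm ⟨x | x⟩).
Definition lnorm (R : realType) (A : cstarAlgType R)
  (X : bimod_data A) (x : X) : R := Num.sqrt (cnorm ⟪x, x⟫).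

Record is_bimodule (R : realType) (A : cstarAlgType R)
    (X : bimod_data A) : Prop := IsBimodule {
  lactDr : forall a (x y : X), a ▷ (x + y) = a ▷ x + a ▷ y;
  lactDl : forall a b (x : X), (a + b) ▷ x = a ▷ x + b ▷ x;
  lactZr : forall (c : R[i]) a (x : X), a ▷ (c *: x) = c *: (a ▷ x);
  lactZl : forall (c : R[i]) a (x : X), (c *: a) ▷ x = c *: (a ▷ x);
  lactA : forall a b (x : X), a ▷ (b ▷ x) = (a * b) ▷ x;
  lact1 : forall x : X, 1 ▷ x = x;
  ractDl : forall a (x y : X), (x + y) ◁ a = x ◁ a + y ◁ a;
  ractDr : forall a b (x : X), x ◁ (a + b) = x ◁ a + x ◁ b;
  ractZl : forall (c : R[i]) a (x : X), (c *: x) ◁ a = c *: (x ◁ a);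
  ractZr : forall (c : R[i]) a (x : X), x ◁ (c *: a) = c *: (x ◁ a);
  ractA : forall a b (x : X), (x ◁ a) ◁ b = x ◁ (a * b);
  ract1 : forall x : X, x ◁ 1 = x;
  lractA : forall a b (x : X), (a ▷ x) ◁ b = a ▷ (x ◁ b)
}.

Record is_right_hilbert (R : realType) (A : cstarAlgType R)
    (X : bimod_data A) : Prop := IsRightHilbert {
  ripDr : forall x y z : X, ⟨x | y + z⟩ = ⟨x | y⟩ + ⟨x | z⟩;
  ripZr : forall (c : R[i]) (x y : X), ⟨x | c *: y⟩ = c *: ⟨x | y⟩;
  ripMr : forall (x y : X) a, ⟨x | y ◁ a⟩ = ⟨x | y⟩ * a;
  rip_star : forall x y : X, star ⟨x | y⟩ = ⟨y | x⟩;
  rip_pos : forall x : X, positive_elt ⟨x | x⟩;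
  rip_def : forall x : X, ⟨x | x⟩ = 0 -> x = 0;
  rip_complete : complete_for (@rnorm R A X)
}.

Record is_left_hilbert (R : realType) (A : cstarAlgType R)
    (X : bimod_data A) : Prop := IsLeftHilbert {
  lipDl : forall x y z : X, ⟪x + y, z⟫ = ⟪x, z⟫ + ⟪y, z⟫;
  lipZl : forall (c : R[i]) (x y : X), ⟪c *: x, y⟫ = c *: ⟪x, y⟫;
  lipMl : forall a (x y : X), ⟪a ▷ x, y⟫ = a * ⟪x, y⟫;
  lip_star : forall x y : X, star ⟪x, y⟫ = ⟪y, x⟫;
  lip_pos : forall x : X, positive_elt ⟪x, x⟫;
  lip_def : forall x : X, ⟪x, x⟫ = 0 -> x = 0;
  lip_complete : complete_for (@lnorm R A X)
}.

(* Adjointability of an action is meant as usual: it is a *-representation by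
   adjointable operators, so the adjoint of the action of [a] is that of
   [star a]. *)
Record is_bim_fgp (R : realType) (A : cstarAlgType R)
    (X : bimod_data A) : Prop := IsBimFgp {
  bim_bimodule : is_bimodule X;
  bim_right : is_right_hilbert X;
  bim_left : is_left_hilbert X;
  lact_adj : forall a (x y : X), ⟨a ▷ x | y⟩ = ⟨x | star a ▷ y⟩;
  ract_adj : forall a (x y : X), ⟪x ◁ a, y⟫ = ⟪x, y ◁ star a⟫;
  bim_equiv : exists c d : R, [/\ 0 < c, 0 < d &
    forall x : X, rnorm x <= c * lnorm x /\ lnorm x <= d * rnorm x];
  bim_rbasis : exists (m : nat) (u : 'I_m -> X),
    forall x : X, x = \sum_i u i ◁ ⟨u i | x⟩;
  bim_lbasis : exists (m : nat) (v : 'I_m -> X),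
    forall x : X, x = \sum_j ⟪x, v j⟫ ▷ v j
}.

Record bim_fgp (R : realType) (A : cstarAlgType R) := BimFgp {
  bim_data :> bimod_data A;
  bimP : is_bim_fgp bim_data
}.

(* The dagger of Bim_fgp(A) is the adjoint for the right inner products. *)
Record bim_morphism (R : realType) (A : cstarAlgType R)
    (X Y : bimod_data A) (f : X -> Y) : Prop := BimMorphism {
  bim_morZD : forall (c : R[i]) x y, f (c *: x + y) = c *: f x + f y;
  bim_morL : forall a x, f (a ▷ x) = a ▷ f x;
  bim_morR : forall a x, f (x ◁ a) = f x ◁ a;
  bim_mor_adj : exists g : Y -> X, forall x y, ⟨f x | y⟩ = ⟨x | g y⟩
}.

(* [t] exhibits [Z] as the relative tensor product of [X] and [Y] over [A]: the
   map sending the elementary tensor of [x] and [y] to [t x y] is a unitary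
   bimodule isomorphism onto [Z], the right inner product of the tensor product
   being the usual one.  Thus a unitary from the relative tensor product to [Z]
   is the same thing as such a [t]. *)
Record fusion_unitary (R : realType) (A : cstarAlgType R)
    (X Y Z : bimod_data A) (t : X -> Y -> Z) : Prop := FusionUnitary {
  fusZDl : forall (c : R[i]) x x' y, t (c *: x + x') y = c *: t x y + t x' y;
  fusZDr : forall (c : R[i]) x y y', t x (c *: y + y') = c *: t x y + t x y';
  fus_balanced : forall x a y, t (x ◁ a) y = t x (a ▷ y);
  fusL : forall a x y, t (a ▷ x) y = a ▷ t x y;
  fusR : forall x y a, t x (y ◁ a) = t x y ◁ a;
  fus_rip : forall x y x' y', ⟨t x y | t x' y'⟩ = ⟨y | ⟨x | x'⟩ ▷ y'⟩;
  fus_dense : forall (z : Z) (e : R), 0 < e ->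
    exists (m : nat) (x : 'I_m -> X) (y : 'I_m -> Y),
      rnorm (z - \sum_i t (x i) (y i)) < e
}.

(** * Finite-dimensional Z-graded Hilbert spaces *)

(* A graded space is presented by a homogeneous orthonormal basis indexed by
   [gidx], the basis vector [i] having degree [gdeg i]; morphisms are
   degree-preserving matrices in these bases. *)
Record ghilb := GHilb { gidx : finType; gdeg : gidx -> int }.

Record ghom (C : numClosedFieldType) (H K : ghilb) := GHom {
  gmat :> gidx K -> gidx H -> C;
  gmatP : forall j i, gdeg j != gdeg i -> gmat j i = 0
}.

Fact gid_subproof (C : numClosedFieldType) (H : ghilb) (j i : gidx H) :
  gdeg j != gdeg i -> (j == i)%:R = 0 :> C.
Proof. by case: (j =P i) => [->|//]; rewrite eqxx. Qed.
Definition gid (C : numClosedFieldType) (H : ghilb) : ghom C H H :=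
  GHom (@gid_subproof C H).

Fact gcomp_subproof (C : numClosedFieldType) (H K L : ghilb) (g : ghom C K L)
  (f : ghom C H K) (j : gidx L) (i : gidx H) :
  gdeg j != gdeg i -> \sum_k g j k * f k i = 0.
Proof.
move=> ji; rewrite big1// => k _.
have [jk|jk] := eqVneq (gdeg j) (gdeg k); last by rewrite gmatP// mul0r.
by rewrite (@gmatP _ _ _ f) ?mulr0// -jk.
Qed.
Definition gcomp (C : numClosedFieldType) (H K L : ghilb) (g : ghom C K L)
  (f : ghom C H K) : ghom C H L := GHom (@gcomp_subproof C H K L g f).

Fact glin_subproof (C : numClosedFieldType) (H K : ghilb) (c : C)
  (f g : ghom C H K) (j : gidx K) (i : gidx H) :
  gdeg j != gdeg i -> c * f j i + g j i = 0.
Proof. by move=> ji; rewrite !gmatP// mulr0 addr0. Qed.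
Definition glin (C : numClosedFieldType) (H K : ghilb) (c : C)
  (f g : ghom C H K) : ghom C H K :=
  GHom (@glin_subproof C H K c f g).

Fact gadj_subproof (C : numClosedFieldType) (H K : ghilb) (f : ghom C H K)
  (j : gidx H) (i : gidx K) : gdeg j != gdeg i -> ((f i j)^*)%R = 0.
Proof. by move=> ji; rewrite gmatP ?conjC0// eq_sym. Qed.
Definition gadj (C : numClosedFieldType) (H K : ghilb) (f : ghom C H K)
  : ghom C K H := GHom (@gadj_subproof C H K f).

Definition gtens (H K : ghilb) : ghilb :=
  @GHilb (gidx H * gidx K)%type (fun p => gdeg p.1 + gdeg p.2).

Fact gtensm_subproof (C : numClosedFieldType) (H H' K K' : ghilb)
  (f : ghom C H H') (g : ghom C K K')
  (j : gidx (gtens H' K')) (i : gidx (gtens H K)) :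
  gdeg j != gdeg i -> f j.1 i.1 * g j.2 i.2 = 0.
Proof.
rewrite /=; have [->|ji _] := eqVneq (gdeg j.1) (gdeg i.1).
  by rewrite (inj_eq (addrI _)) => ji; rewrite (@gmatP _ _ _ g)// mulr0.
by rewrite gmatP// mul0r.
Qed.
Definition gtensm (C : numClosedFieldType) (H H' K K' : ghilb)
  (f : ghom C H H') (g : ghom C K K') : ghom C (gtens H K) (gtens H' K') :=
  GHom (@gtensm_subproof C H H' K K' f g).

Definition gline (k : int) : ghilb := @GHilb unit (fun=> k).

Fact gassoc_subproof (C : numClosedFieldType) (H K L : ghilb)
  (j : gidx (gtens H (gtens K L))) (i : gidx (gtens (gtens H K) L)) :
  gdeg j != gdeg i -> (j == (i.1.1, (i.1.2, i.2)))%:R = 0 :> C.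
Proof.
case: (j =P (i.1.1, (i.1.2, i.2))) => [->|//].
by rewrite /= addrA eqxx.
Qed.
Definition gassoc (C : numClosedFieldType) (H K L : ghilb)
  : ghom C (gtens (gtens H K) L) (gtens H (gtens K L)) :=
  GHom (@gassoc_subproof C H K L).

Fact glunit_subproof (C : numClosedFieldType) (H : ghilb)
  (j : gidx H) (i : gidx (gtens (gline 0) H)) :
  gdeg j != gdeg i -> (j == i.2)%:R = 0 :> C.
Proof. by case: (j =P i.2) => [->|//]; rewrite /= add0r eqxx. Qed.
Definition glunit (C : numClosedFieldType) (H : ghilb)
  : ghom C (gtens (gline 0) H) H := GHom (@glunit_subproof C H).

Fact grunit_subproof (C : numClosedFieldType) (H : ghilb)
  (j : gidx H) (i : gidx (gtens H (gline 0))) :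
  gdeg j != gdeg i -> (j == i.1)%:R = 0 :> C.
Proof. by case: (j =P i.1) => [->|//]; rewrite /= addr0 eqxx. Qed.
Definition grunit (C : numClosedFieldType) (H : ghilb)
  : ghom C (gtens H (gline 0)) H := GHom (@grunit_subproof C H).

(* The identification of the tensor product of the lines of degrees [k] and [l]
   with the line of degree [m = k + l]; it is the zero morphism when
   [m != k + l]. *)
Fact gmerge_subproof (C : numClosedFieldType) (k l m : int)
  (j : gidx (gline m)) (i : gidx (gtens (gline k) (gline l))) :
  gdeg j != gdeg i -> (m == k + l)%:R = 0 :> C.
Proof. by move=> /= /negbTE->. Qed.
Definition gmerge (C : numClosedFieldType) (k l m : int)
  : ghom C (gtens (gline k) (gline l)) (gline m) :=
  GHom (@gmerge_subproof C k l m).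

(** * Unitary tensor functors from graded Hilbert spaces to bimodules *)

(* [fun2 H K x y] is the value of the tensorator on the elementary tensor of [x]
   and [y]. *)
Record utfunctor (R : realType) (A : cstarAlgType R) := UTFunctor {
  fob :> ghilb -> bim_fgp A;
  fmor : forall H K, ghom R[i] H K -> fob H -> fob K;
  fun0 : A -> fob (gline 0);
  fun2 : forall H K, fob H -> fob K -> fob (gtens H K);
  fmorP : forall H K (f : ghom R[i] H K), bim_morphism (fmor f);
  fmor_id : forall H (x : fob H), fmor (gid R[i] H) x = x;
  fmor_comp : forall H K L (g : ghom R[i] K L) (f : ghom R[i] H K) (x : fob H),
    fmor (gcomp g f) x = fmor g (fmor f x);
  fmor_lin : forall H K (c : R[i]) (f g : ghom R[i] H K) (x : fob H),
    fmor (glin c f g) x = c *: fmor f x + fmor g x;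
  fmor_adj : forall H K (f : ghom R[i] H K) (x : fob H) (y : fob K),
    ⟨fmor f x | y⟩ = ⟨x | fmor (gadj f) y⟩;
  fun0_bij : bijective fun0;
  fun0ZD : forall (c : R[i]) a b, fun0 (c *: a + b) = c *: fun0 a + fun0 b;
  fun0L : forall a b, fun0 (a * b) = a ▷ fun0 b;
  fun0R : forall a b, fun0 (a * b) = fun0 a ◁ b;
  fun0_rip : forall a b, ⟨fun0 a | fun0 b⟩ = star a * b;
  fun2P : forall H K, fusion_unitary (@fun2 H K);
  fun2_nat : forall H H' K K' (f : ghom R[i] H H') (g : ghom R[i] K K')
    (x : fob H) (y : fob K),
    fmor (gtensm f g) (fun2 x y) = fun2 (fmor f x) (fmor g y);
  fun2A : forall H K L (x : fob H) (y : fob K) (z : fob L),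
    fmor (gassoc R[i] H K L) (fun2 (fun2 x y) z) = fun2 x (fun2 y z);
  fun2_0l : forall H a (x : fob H), fmor (glunit R[i] H) (fun2 (fun0 a) x) = a ▷ x;
  fun2_0r : forall H a (x : fob H), fmor (grunit R[i] H) (fun2 x (fun0 a)) = x ◁ a
}.
Arguments fmor {R A} F {H K} f x : rename.
Arguments fun0 {R A} F a : rename.
Arguments fun2 {R A} F {H K} x y : rename.

Definition fully_faithful (R : realType) (A : cstarAlgType R)
    (F : utfunctor A) : Prop :=
  forall H K : ghilb,
    injective (fun f : ghom R[i] H K => fmor F f) /\
    (forall h : F H -> F K, bim_morphism h ->
       exists f : ghom R[i] H K, fmor F f = h).

(** * Inclusions with expectation *)

Record unital_inclusion (R : realType) (A B : cstarAlgType R)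
    (i : A -> B) : Prop := UnitalInclusion {
  incl_hom : star_hom i;
  incl_norm : forall a, cnorm (i a) = cnorm a
}.

Record faithful_expectation (R : realType) (A B : cstarAlgType R)
    (i : A -> B) (E : B -> A) : Prop := FaithfulExpectation {
  expZD : forall (c : R[i]) x y, E (c *: x + y) = c *: E x + E y;
  exp_id : forall a, E (i a) = a;
  exp_bimod : forall a x b, E (i a * x * i b) = a * E x * b;
  exp_pos : forall x, positive_elt (E (star x * x));
  exp_faithful : forall x, E (star x * x) = 0 -> x = 0
}.

Definition irreducible_inclusion (R : realType) (A B : cstarAlgType R)
    (i : A -> B) : Prop :=
  forall b : B, (forall a, i a * b = b * i a) -> exists c : R[i], b = c *: 1.

(* The sub-bimodule [K] is given as the range of a bimodule embedding [f],
   through which the right inner product of [X] is [E (x^* y)]. *)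
Definition PQN (R : realType) (A B : cstarAlgType R)
    (i : A -> B) (E : B -> A) : set B :=
  [set b : B | exists (X : bim_fgp A) (f : X -> B),
    [/\ forall (c : R[i]) x y, f (c *: x + y) = c *: f x + f y,
        forall a x, f (a ▷ x) = i a * f x,
        forall a x, f (x ◁ a) = f x * i a,
        injective f /\ (forall x y, ⟨x | y⟩ = E (star (f x) * f y)) &
        exists x, f x = b]].

Record irreducible_cdiscrete (R : realType) (A B : cstarAlgType R)
    (i : A -> B) (E : B -> A) : Prop := IrreducibleCDiscrete {
  icd_inclusion : unital_inclusion i;
  icd_expectation : faithful_expectation i E;
  icd_irreducible : irreducible_inclusion i;
  icd_discrete : dense_in (PQN i E)
}.

Record inclusion_iso (R : realType) (A B D : cstarAlgType R)
    (i : A -> B) (E : B -> A) (i' : A -> D) (E' : D -> A) (f : B -> D)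
  : Prop := InclusionIso {
  iiso_iso : star_iso f;
  iiso_incl : forall a, f (i a) = i' a;
  iiso_exp : forall b, E' (f b) = E b
}.

(** * The reduced crossed product by the group algebra of Z *)

Section CrossedProduct.
Context (R : realType) (A : cstarAlgType R) (F : utfunctor A).

(* Families; the algebraic direct sum consists of those of finite support. *)
Definition zfam : Type := forall k : int, F (gline k).
Definition finsupp (x : zfam) : Prop := finite_set [set k | x k != 0].

Definition gprod (k l m : int) (x : F (gline k)) (y : F (gline l))
  : F (gline m) := fmor F (gmerge R[i] k l m) (fun2 F x y).

(* Convolution product, for [x] of finite support. *)
Definition zmul (x y : zfam) : zfam :=
  fun m => \sum_(k \in [set: int]) gprod m (x k) (y (m - k)).

(* [y] in degree [-k] is the involution of [x] in degree [k]. *)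
Definition is_gstar (k : int) (x : F (gline k)) (y : F (gline (- k))) : Prop :=
  forall z : F (gline k), gprod 0 y z = fun0 F ⟨x | z⟩.

(* [y] lies in the Hilbert module direct sum, with [<y | y> = S]. *)
Definition hsum (y : zfam) (S : A) : Prop :=
  forall e : R, 0 < e -> exists K0 : {fset int}, forall K : {fset int},
    (K0 `<=` K)%fset -> cnorm (\sum_(k <- K) ⟨y k | y k⟩ - S) < e.

Definition lmul_bound (x : zfam) (c : R) : Prop :=
  forall y S, hsum y S ->
    exists2 T, hsum (zmul x y) T & Num.sqrt (cnorm T) <= c * Num.sqrt (cnorm S).

Definition is_lmul_norm (x : zfam) (r : R) : Prop :=
  [/\ 0 <= r, lmul_bound x r &
      forall c, 0 <= c -> lmul_bound x c -> r <= c].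

Definition zembed (D : cstarAlgType R) (j : forall k : int, F (gline k) -> D)
  (x : zfam) : D := \sum_(k \in [set: int]) j k (x k).

(* [D] is the completion of the algebraic direct sum, [j k] being the inclusion
   of its component of degree [k].  As any completion, it is determined up to a
   unique isomorphism. *)
Record is_reduced_crossed_product (D : cstarAlgType R)
    (j : forall k : int, F (gline k) -> D) : Prop := IsReducedCrossedProduct {
  rcpZD : forall k (c : R[i]) x y, j k (c *: x + y) = c *: j k x + j k y;
  rcp1 : j 0 (fun0 F 1) = 1;
  rcpM : forall k l (x : F (gline k)) (y : F (gline l)),
    j k x * j l y = j (k + l) (gprod (k + l) x y);
  rcp_star : forall k (x : F (gline k)) (y : F (gline (- k))),
    is_gstar x y -> star (j k x) = j (- k) y;
  rcp_norm : forall x, finsupp x -> is_lmul_norm x (cnorm (zembed j x));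
  rcp_dense : dense_in [set zembed j x | x in finsupp]
}.

Definition rcp_incl (D : cstarAlgType R) (j : forall k : int, F (gline k) -> D)
  (a : A) : D := j 0 (fun0 F a).

Definition is_rcp_expectation (D : cstarAlgType R)
    (j : forall k : int, F (gline k) -> D) (E' : D -> A) : Prop :=
  (forall d (e : R), 0 < e -> exists2 h : R, 0 < h &
     forall d', cnorm (d' - d) < h -> cnorm (E' d' - E' d) < e) /\
  forall x, finsupp x -> fun0 F (E' (zembed j x)) = x 0.

End CrossedProduct.

(** * Cuntz algebras and the gauge action *)

Record cuntz_relations (R : realType) (n : nat) (B : cstarAlgType R)
    (t : 'I_n -> B) : Prop := CuntzRelations {
  cuntz_isom : forall i j, star (t i) * t j = (i == j)%:R;
  cuntz_sum : \sum_i t i * star (t i) = 1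
}.

Definition is_cuntz_algebra (R : realType) (n : nat)
    (O : cstarAlgType R) (s : 'I_n -> O) : Prop :=
  cuntz_relations s /\
  forall (B : cstarAlgType R) (t : 'I_n -> B), cuntz_relations t ->
    exists! f : O -> B, star_hom f /\ (forall i, f (s i) = t i).

Record is_gauge_action (R : realType) (n : nat) (O : cstarAlgType R)
    (s : 'I_n -> O) (g : R[i] -> O -> O) : Prop := IsGaugeAction {
  gauge_iso : forall z, `|z| = 1 -> star_iso (g z);
  gauge_id : forall x, g 1 x = x;
  gauge_mul : forall z w x, `|z| = 1 -> `|w| = 1 -> g (z * w) x = g z (g w x);
  gauge_gen : forall z i, `|z| = 1 -> g z (s i) = z *: s i
}.

Definition is_gauge_fixed_algebra (R : realType)
    (O A : cstarAlgType R) (g : R[i] -> O -> O) (i : A -> O) : Prop :=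
  unital_inclusion i /\
  range i = [set x | forall z, `|z| = 1 -> g z x = x].

(* Riemann integral over [0, 1] of a vector-valued function. *)
Definition is_riemann_integral (R : realType) (V : cstarAlgType R)
    (f : R -> V) (v : V) : Prop :=
  forall e : R, 0 < e -> exists2 d : R, 0 < d &
    forall (m : nat) (p t : nat -> R), p 0%N = 0 -> p m = 1 ->
      (forall k, (k < m)%N ->
         [/\ p k <= t k, t k <= p k.+1 & p k.+1 - p k < d]) ->
      cnorm (\sum_(k < m) ((p k.+1 - p k)%:C)%C *: f (t k) - v) < e.

Definition circle_exp (R : realType) (t : R) : R[i] :=
  Complex (cos (2 * pi * t)) (sin (2 * pi * t)).

(* Normalized Haar measure on the circle is the image of Lebesgue measure on
   [0, 1] under [circle_exp]; gauge orbits are norm-continuous, so that the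
   average is a Riemann integral. *)
Definition is_gauge_average (R : realType) (O A : cstarAlgType R)
    (g : R[i] -> O -> O) (i : A -> O) (E : O -> A) : Prop :=
  forall x, is_riemann_integral (fun t : R => g (circle_exp t) x) (i (E x)).

Definition spectral_bimodule (R : realType) (O A : cstarAlgType R)
    (i : A -> O) (s1 : O) (k : int) : set O :=
  match k with
  | Posz m => [set i a * s1 ^+ m | a in [set: A]]
  | Negz m => [set star s1 ^+ m.+1 * i a | a in [set: A]]
  end.

(* [e] identifies the bimodule [X], with all its structure, with the
   sub-bimodule [K] of [O] with inner products [x^* y] and [x y^*]. *)
Record identifies_with (R : realType) (O A : cstarAlgType R)
    (i : A -> O) (X : bimod_data A) (K : set O) (e : X -> O)
  : Prop := IdentifiesWith {
  idwZD : forall (c : R[i]) x y, e (c *: x + y) = c *: e x + e y;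
  idw_inj : injective e;
  idw_range : range e = K;
  idwL : forall a x, e (a ▷ x) = i a * e x;
  idwR : forall a x, e (x ◁ a) = e x * i a;
  idw_rip : forall x y, i ⟨x | y⟩ = star (e x) * e y;
  idw_lip : forall x y, i ⟪x, y⟫ = e x * star (e y)
}.

(* The functor [F] takes the prescribed values on the simple objects, with unit
   constraint the identity of [A] and tensorator the product of [O]; [e]
   records the identifications. *)
Record is_gauge_functor (R : realType) (O A : cstarAlgType R)
    (i : A -> O) (s1 : O) (F : utfunctor A)
    (e : forall k : int, F (gline k) -> O) : Prop := IsGaugeFunctor {
  gf_ob : forall k, identifies_with i (spectral_bimodule i s1 k) (e k);
  gf_unit : forall a, e 0 (fun0 F a) = i a;
  gf_mul : forall k l (x : F (gline k)) (y : F (gline l)),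
    e (k + l) (gprod (k + l) x y) = e k x * e l y
}.

(* Main.v *)
From HB Require Import structures.
From mathcomp Require Import finmap.
Require Import Defs.
From mathcomp Require Import all_boot all_order all_algebra.
From mathcomp Require Import complex.
From mathcomp Require Import all_classical all_reals all_analysis.
From mathcomp Require Import ring lra.
Set Implicit Arguments.
Unset Strict Implicit.
Unset Printing Implicit Defensive.
Import Order.TTheory GRing.Theory Num.Theory.
Import numFieldNormedType.Exports.
Local Open Scope ring_scope.

(* For a C*-algebra, positivity is handled through squares of self-adjoint
   elements: square roots come from a norm-convergent iteration, and Kaplansky's
   argument shows that [star b * b] is such a square.  Hence unital *-homomorphisms
   are contractive, and isometric when injective.

   The spectral subspaces of the gauge action form a graded family containing the
   generators, so they span a dense *-subalgebra of [O]; averaging annihilates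
   the nonzero degrees, and orbit continuity makes [E] faithful.  An element [b]
   of the commutant of [A] induces bimodule maps [x |-> E (b x)] from the objects
   [F (gline k)] to [A], which full faithfulness forces to be zero for [k <> 0]
   and scalar for [k = 0]: this is irreducibility.

   By universality there is a *-homomorphism [f : O -> D] sending [s_l] to the copy of
   [s_l] in degree 1 of [D].  It is the identification on every spectral subspace,
   so [E' (f y) = E y] by density; faithfulness of [E] makes [f] injective, hence
   isometric, and its range is dense and complete, hence all of [D]. *)

(** The universal property speaks of homomorphisms out of [O]; that the generators generate [O] has
    to be extracted from its uniqueness half, after which statements about all of [O] reduce to
    homogeneous elements. It controls [f] only on polynomials in the generators, whereas the
    spectral bimodules have coefficients in the norm-closed algebra [A]. Agreement on [A] is
    therefore proved as an identity [f (i (E y)) = rcp_incl j (E y)] of continuous maps of [y] in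
    [O], tested degree by degree; agreement on the bimodules follows by multiplicativity. Positivity
    serves three purposes: contractivity makes homomorphisms continuous, isometry closes the range
    of [f], and monotonicity of the norm on positive elements bounds one arc of a gauge orbit by the
    whole average. *)

Section LinearMaps.
Context (K : pzRingType) (V W : lmodType K) (f : V -> W).
Hypothesis fZD : forall c x y, f (c *: x + y) = c *: f x + f y.

Lemma zd_mapD x y : f (x + y) = f x + f y.
Proof. by rewrite -[x in LHS]scale1r fZD scale1r. Qed.

Lemma zd_map0 : f 0 = 0.
Proof. by apply: (addrI (f 0)); rewrite -zd_mapD !addr0. Qed.

Lemma zd_mapZ c x : f (c *: x) = c *: f x.
Proof. by rewrite -[_ *: x]addr0 fZD zd_map0 addr0. Qed.

Lemma zd_mapB x y : f (x - y) = f x - f y.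
Proof. by rewrite zd_mapD -scaleN1r zd_mapZ scaleN1r. Qed.

Lemma zd_map_sum (I : Type) (r : seq I) (P : pred I) (G : I -> V) :
  f (\sum_(k <- r | P k) G k) = \sum_(k <- r | P k) f (G k).
Proof. exact: (big_morph _ zd_mapD zd_map0). Qed.

End LinearMaps.

(** * Norm identities and norm limits in a C*-algebra *)

Section CStarNorm.
Context (R : realType) (A : cstarAlgType R).
Implicit Types (x y z : A) (t : R).

Lemma normc_real t : Normc.normc (t%:C)%C = `|t|.
Proof. by rewrite /= expr0n /= addr0 sqrtr_sqr. Qed.

Lemma star0 : star (0 : A) = 0.
Proof. by apply: (addrI (star 0)); rewrite -starD !addr0. Qed.

Lemma starN x : star (- x) = - star x.
Proof. by apply: (addrI (star x)); rewrite -starD !subrr star0. Qed.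

Lemma starB x y : star (x - y) = star x - star y.
Proof. by rewrite starD starN. Qed.

Lemma star1 : star (1 : A) = 1.
Proof. by rewrite -[LHS]mulr1 -{2}[1]starK -starM mulr1 starK. Qed.

Lemma starX x m : star (x ^+ m) = star x ^+ m.
Proof. by elim: m => [|m IH]; rewrite ?star1// exprS starM IH exprSr. Qed.

Lemma star_sum (I : Type) (r : seq I) (P : pred I) (f : I -> A) :
  star (\sum_(k <- r | P k) f k) = \sum_(k <- r | P k) star (f k).
Proof. exact: (big_morph _ (@starD _ A) star0). Qed.

Lemma starZr t x : star ((t%:C)%C *: x) = (t%:C)%C *: star x.
Proof. by rewrite starZ; congr (_ *: _); exact: conjc_real. Qed.

Lemma cnorm0 : cnorm (0 : A) = 0.
Proof. by rewrite -(scale0r 0) cnormZ Normc.normc0 mul0r. Qed.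

Lemma cnormN x : cnorm (- x) = cnorm x.
Proof.
by rewrite -scaleN1r cnormZ (_ : Normc.normc _ = 1) ?mul1r// -[RHS]Normc.normc1 normcN.
Qed.

Lemma cnorm_ge0 x : 0 <= cnorm x.
Proof.
have := cnormD x (- x); rewrite subrr cnorm0 cnormN -mulr2n.
by rewrite pmulrn_lge0.
Qed.

Lemma cnormC x y : cnorm (x - y) = cnorm (y - x).
Proof. by rewrite -cnormN opprB. Qed.

Lemma cnorm_tri x y z : cnorm (x - z) <= cnorm (x - y) + cnorm (y - z).
Proof. by rewrite -[x in leLHS](subrK y) -addrA cnormD. Qed.

Lemma cnorm_sum (I : Type) (r : seq I) (P : pred I) (f : I -> A) :
  cnorm (\sum_(k <- r | P k) f k) <= \sum_(k <- r | P k) cnorm (f k).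
Proof.
elim/big_ind2: _ => [|x a y b xa yb|//]; first by rewrite cnorm0.
exact: le_trans (cnormD _ _) (lerD xa yb).
Qed.

Lemma cnormZr t x : cnorm ((t%:C)%C *: x) = `|t| * cnorm x.
Proof. by rewrite cnormZ normc_real. Qed.

Lemma cnormE x : cnorm (star x) = cnorm x.
Proof.
suff le y : cnorm y <= cnorm (star y).
  by apply/eqP; rewrite eq_le le andbT -{2}[x]starK le.
have [->|y0] := eqVneq (cnorm y) 0; first exact: cnorm_ge0.
have yp : 0 < cnorm y by rewrite lt_def y0 cnorm_ge0.
by rewrite -(ler_pM2r yp) -expr2 -cnorm_star cnormM.
Qed.

Lemma cnorm_starr x : cnorm (x * star x) = cnorm x ^+ 2.
Proof. by rewrite -{1}[x]starK cnorm_star cnormE. Qed.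

Lemma cnorm_sqr x : star x = x -> cnorm (x * x) = cnorm x ^+ 2.
Proof. by move=> xs; rewrite -cnorm_star xs. Qed.

Lemma cnorm1 : cnorm (1 : A) = 1.
Proof.
have := cnorm_star (1 : A); rewrite star1 mulr1.
have : cnorm (1 : A) != 0.
  by apply: contraTN isT => /eqP/cnorm0_eq0/eqP; rewrite oner_eq0.
move=> n0 /esym/eqP; rewrite expr2 -subr_eq0 -[X in _ - X]mulr1 -mulrBr.
by rewrite mulf_eq0 (negbTE n0) subr_eq0 => /eqP.
Qed.

Lemma star_mul_eq0 x : star x * x = 0 -> x = 0.
Proof.
move=> xx; apply: cnorm0_eq0; apply/eqP.
by rewrite -sqrf_eq0 -cnorm_star xx cnorm0.
Qed.

Lemma cnorm_small x : (forall e, 0 < e -> cnorm x <= e) -> x = 0.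
Proof.
move=> xe; apply: cnorm0_eq0; apply/eqP; rewrite eq_le cnorm_ge0 andbT.
by apply/ler_addgt0Pr => e e0; rewrite add0r xe.
Qed.

Definition cvg_cnorm (u : nat -> A) (l : A) := forall e : R, 0 < e ->
  exists M : nat, forall p : nat, (M <= p)%N -> cnorm (u p - l) < e.

Lemma cvg_cnorm_cst x : cvg_cnorm (fun=> x) x.
Proof. by move=> e e0; exists 0 => p _; rewrite subrr cnorm0. Qed.

Lemma cvg_cnorm_le u l c : cvg_cnorm u l ->
  (exists M : nat, forall p, (M <= p)%N -> cnorm (u p) <= c) -> cnorm l <= c.
Proof.
move=> ul [M Mc]; apply/ler_addgt0Pr => e e0.
have [N Nl] := ul e e0.
rewrite -(subrK (u (maxn M N)) l) addrC (le_trans (cnormD _ _))//.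
by rewrite lerD ?Mc ?leq_maxl// cnormC ltW// Nl ?leq_maxr.
Qed.

Lemma cvg_cnormD u v k l : cvg_cnorm u k -> cvg_cnorm v l ->
  cvg_cnorm (fun p => u p + v p) (k + l).
Proof.
move=> uk vl e e0; have e2 : 0 < e / 2 by rewrite divr_gt0.
have [M Mk] := uk _ e2; have [N Nl] := vl _ e2.
exists (maxn M N) => p; rewrite geq_max => /andP[/Mk pk /Nl pl].
rewrite opprD addrACA (le_lt_trans (cnormD _ _))// [e](splitr e).
exact: ltrD.
Qed.

Lemma cvg_cnorm_lip (f : A -> A) c u l :
  (forall x y, cnorm (f x - f y) <= c * cnorm (x - y)) ->
  cvg_cnorm u l -> cvg_cnorm (fun p => f (u p)) (f l).
Proof.
move=> fc ul e e0; have c0 : 0 < `|c| + 1 by rewrite ltr_wpDl.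
have [M Ml] := ul _ (divr_gt0 e0 c0); exists M => p /Ml.
rewrite ltr_pdivlMr// => le; apply: (le_lt_trans _ le).
rewrite (le_trans (fc _ _))// mulrC ler_wpM2l ?cnorm_ge0//.
by rewrite (le_trans (ler_norm c))// lerDl.
Qed.

Lemma cvg_cnormZ c u l : cvg_cnorm u l -> cvg_cnorm (fun p => c *: u p) (c *: l).
Proof.
apply: (@cvg_cnorm_lip (fun x => c *: x) (Normc.normc c)) => x y.
by rewrite -scalerBr cnormZ.
Qed.

Lemma cvg_cnormN u l : cvg_cnorm u l -> cvg_cnorm (fun p => - u p) (- l).
Proof.
apply: (@cvg_cnorm_lip (fun x => - x) 1) => x y.
by rewrite -opprD cnormN mul1r.
Qed.

Lemma cvg_cnorm_star u l :
  cvg_cnorm u l -> cvg_cnorm (fun p => star (u p)) (star l).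
Proof.
apply: (@cvg_cnorm_lip (@star R A) 1) => x y.
by rewrite -starB cnormE mul1r.
Qed.

Lemma cvg_cnormMl a u l : cvg_cnorm u l -> cvg_cnorm (fun p => a * u p) (a * l).
Proof.
apply: (@cvg_cnorm_lip (fun x => a * x) (cnorm a)) => x y.
by rewrite -mulrBr cnormM.
Qed.

Lemma cvg_cnormMr a u l : cvg_cnorm u l -> cvg_cnorm (fun p => u p * a) (l * a).
Proof.
apply: (@cvg_cnorm_lip (fun x => x * a) (cnorm a)) => x y.
by rewrite -mulrBl mulrC cnormM.
Qed.

Lemma cvg_cnorm_uniq u k l : cvg_cnorm u k -> cvg_cnorm u l -> k = l.
Proof.
move=> uk /cvg_cnormN ul; apply/eqP; rewrite -subr_eq0; apply/eqP/cnorm_small.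
move=> e e0; apply: (cvg_cnorm_le (cvg_cnormD uk ul)).
by exists 0 => p _; rewrite subrr cnorm0 ltW.
Qed.

Lemma cvg_cnorm_bounded u l : cvg_cnorm u l ->
  exists2 M, 0 < M & exists N : nat, forall p, (N <= p)%N -> cnorm (u p) <= M.
Proof.
move=> ul; exists (cnorm l + 1); first by rewrite ltr_wpDl ?cnorm_ge0.
have [N Nl] := ul 1 ltr01; exists N => p /Nl pl.
by rewrite -(subrK l (u p)) addrC (le_trans (cnormD _ _))// lerD2l ltW.
Qed.

Lemma cvg_cnormM u v k l : cvg_cnorm u k -> cvg_cnorm v l ->
  cvg_cnorm (fun p => u p * v p) (k * l).
Proof.
move=> uk vl e e0; have [M M0 [N NM]] := cvg_cnorm_bounded uk.
have e2 : 0 < e / 2 by rewrite divr_gt0.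
have [N1 N1l] := vl _ (divr_gt0 e2 M0).
have [N2 N2l] := cvg_cnormMr l uk e2.
exists (maxn N (maxn N1 N2)) => p; rewrite !geq_max => /and3P[/NM pM /N1l p1 /N2l p2].
rewrite (_ : u p * v p - k * l = u p * (v p - l) + (u p * l - k * l)); last first.
  by rewrite mulrBr addrA subrK.
rewrite (le_lt_trans (cnormD _ _))// [e](splitr e) ltr_leD ?ltW//.
rewrite (le_lt_trans (cnormM _ _))//.
move: p1; rewrite ltr_pdivlMr// mulrC => p1; apply: le_lt_trans p1.
by rewrite ler_wpM2r ?cnorm_ge0.
Qed.

Lemma cvg_cnormS u l : cvg_cnorm u l -> cvg_cnorm (fun p => u p.+1) l.
Proof. by move=> ul e /ul[M Ml]; exists M => p Mp; apply: Ml; apply: leqW. Qed.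

End CStarNorm.

(** * Square roots *)

Lemma subr_sqr_comm (S : pzRingType) (x y : S) :
  GRing.comm x y -> x ^+ 2 - y ^+ 2 = (x - y) * (x + y).
Proof.
by move=> xy; rewrite mulrBl !mulrDr -!expr2 xy opprD addrA addrK.
Qed.

Lemma commrZ (K : pzRingType) (S : algType K) (c : K) (x y : S) :
  GRing.comm x y -> GRing.comm x (c *: y).
Proof. by rewrite /GRing.comm -scalerAr -scalerAl => ->. Qed.

Section SquareRoot.
Context (R : realType).

Fixpoint sqrt_bound (k : nat) : R :=
  if k is k'.+1 then (1 + sqrt_bound k' ^+ 2) / 2 else 0.

Lemma sqrt_bound_itv k : 0 <= sqrt_bound k <= 1.
Proof.
elim: k => [|k /andP[IH1 IH2]] /=; first by rewrite lexx ler01.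
by apply/andP; split; nra.
Qed.

Lemma sqrt_bound_nd k : sqrt_bound k <= sqrt_bound k.+1.
Proof.
rewrite /= -subr_ge0; set c := sqrt_bound k.
by rewrite (_ : _ - c = (1 - c) ^+ 2 / 2) ?divr_ge0 ?sqr_ge0//; field.
Qed.

Lemma sqrt_bound_cauchy (e : R) : 0 < e -> exists M : nat, forall p q : nat,
  (M <= p)%N -> (M <= q)%N -> `|sqrt_bound p - sqrt_bound q| < e.
Proof.
move=> e0; have cv : cvgn sqrt_bound.
  apply: nondecreasing_is_cvgn.
    by apply/nondecreasing_seqP => k; exact: sqrt_bound_nd.
  by exists 1 => _ [k _ <-]; have /andP[] := sqrt_bound_itv k.
have e2 : 0 < e / 2 by rewrite divr_gt0.
have /cvgrPdist_lt/(_ _ e2)[M _ Ml] := cv; exists M => p q Mp Mq.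
rewrite -(subrK (limn sqrt_bound) (sqrt_bound p)) -addrA [e](splitr e).
by rewrite (le_lt_trans (ler_normD _ _))// ltrD// ?Ml// distrC Ml.
Qed.

Context (A : cstarAlgType R).
Implicit Types (x y z : A).

(* The fixed-point iteration for [z = (y + z^2)/2], i.e. [(1 - z)^2 = 1 - y];
   it is dominated by the same iteration for the scalar [y = 1]. *)
Fixpoint sqrt_iter y (k : nat) : A :=
  if k is k'.+1 then ((2^-1 : R)%:C)%C *: (y + sqrt_iter y k' ^+ 2) else 0.

Lemma sqrt_iter_comm y c k : GRing.comm c y -> GRing.comm c (sqrt_iter y k).
Proof.
move=> cy; elim: k => [|k IH] /=; first exact: GRing.commr0.
by apply: commrZ; apply: GRing.commrD => //; apply: GRing.commrX.
Qed.

Lemma sqrt_iter_commi y k l : GRing.comm (sqrt_iter y k) (sqrt_iter y l).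
Proof. by apply: sqrt_iter_comm; apply/commr_sym/sqrt_iter_comm. Qed.

Lemma star_sqrt_iter y k : star y = y -> star (sqrt_iter y k) = sqrt_iter y k.
Proof.
move=> ys; elim: k => [|k IH] /=; first exact: star0.
by rewrite starZr starD starX IH ys.
Qed.

Lemma cnorm_half x : cnorm (((2^-1 : R)%:C)%C *: x) = cnorm x / 2.
Proof. by rewrite cnormZr ger0_norm ?invr_ge0// mulrC. Qed.

Lemma sqrt_iter_bound y k : cnorm y <= 1 -> cnorm (sqrt_iter y k) <= sqrt_bound k.
Proof.
move=> y1; elim: k => [|k IH] /=; first by rewrite cnorm0.
rewrite cnorm_half ler_pM2r ?invr_gt0// (le_trans (cnormD _ _))// lerD//.
by rewrite expr2 (le_trans (cnormM _ _))// expr2 ler_pM ?cnorm_ge0.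
Qed.

(** Iterates commute, so the next difference is [(z' - z) (z' + z) / 2]. The scalar iteration
    satisfies the same identity, and bounding both factors carries the estimate to the next
    index. *)
Lemma sqrt_iter_step y k : cnorm y <= 1 ->
  cnorm (sqrt_iter y k.+1 - sqrt_iter y k) <= sqrt_bound k.+1 - sqrt_bound k.
Proof.
move=> y1; elim: k => [|k IH].
  rewrite !subr0 [sqrt_iter _ _]/= cnorm_half /= expr0n/= expr0n/= !addr0.
  by rewrite ler_pM2r ?invr_gt0.
have -> : sqrt_iter y k.+2 - sqrt_iter y k.+1 = ((2^-1 : R)%:C)%C *:
    ((sqrt_iter y k.+1 - sqrt_iter y k) * (sqrt_iter y k.+1 + sqrt_iter y k)).
  rewrite -subr_sqr_comm; last exact: sqrt_iter_commi.
  by rewrite {1}/sqrt_iter -/(sqrt_iter y k.+1) {2}/sqrt_iter -/sqrt_iter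
    -scalerBr opprD addrACA subrr add0r.
have -> : sqrt_bound k.+2 - sqrt_bound k.+1 =
    (sqrt_bound k.+1 - sqrt_bound k) * (sqrt_bound k.+1 + sqrt_bound k) / 2.
  by rewrite -subr_sqr {1}/sqrt_bound -/(sqrt_bound k.+1) {2}/sqrt_bound -/sqrt_bound; field.
rewrite cnorm_half ler_pM2r ?invr_gt0// (le_trans (cnormM _ _))//.
rewrite ler_pM ?cnorm_ge0// (le_trans (cnormD _ _))// lerD//;
exact: sqrt_iter_bound.
Qed.

Lemma sqrt_iter_dist y p q : cnorm y <= 1 -> (p <= q)%N ->
  cnorm (sqrt_iter y q - sqrt_iter y p) <= sqrt_bound q - sqrt_bound p.
Proof.
move=> y1 /subnK <-; elim: (q - p)%N => [|d IH].
  by rewrite add0n !subrr cnorm0.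
rewrite addSn (le_trans (cnorm_tri _ (sqrt_iter y (d + p)) _))//.
by rewrite -(subrK (sqrt_bound (d + p)) (sqrt_bound _.+1)) -addrA lerD// sqrt_iter_step.
Qed.

Lemma sqrt_iter_cvg y : cnorm y <= 1 -> exists z, cvg_cnorm (sqrt_iter y) z.
Proof.
move=> y1; apply: (@cnorm_complete R A) => e e0.
have [M Ml] := sqrt_bound_cauchy e0; exists M => p q Mp Mq.
wlog pq : p q Mp Mq / (p <= q)%N => [hw|].
  have /orP[pq|qp] := leq_total p q; first exact: hw.
  by rewrite cnormC; exact: hw.
rewrite cnormC (le_lt_trans (sqrt_iter_dist y1 pq))//.
by rewrite (le_lt_trans (ler_norm _))// Ml.
Qed.

(** The fixed-point equation of the limit rearranges to the square identity. The last clause stands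
    in for membership in the algebra generated by [y]: whatever commutes with [y] commutes with the
    iterates, hence with their limit. *)
Lemma unit_sqrt y : star y = y -> cnorm y <= 1 ->
  exists z, [/\ star z = z, cnorm z <= 1, (1 - z) ^+ 2 = 1 - y &
    forall c, GRing.comm c y -> GRing.comm c z].
Proof.
move=> ys y1; have [z zl] := sqrt_iter_cvg y1.
have zE : z = ((2^-1 : R)%:C)%C *: (y + z ^+ 2).
  apply: (cvg_cnorm_uniq (cvg_cnormS zl)); apply: cvg_cnormZ.
  by apply: cvg_cnormD; [exact: cvg_cnorm_cst | rewrite expr2; apply: cvg_cnormM].
exists z; split.
- apply: (cvg_cnorm_uniq (cvg_cnorm_star zl)); move=> e /zl[M Ml].
  by exists M => p /Ml; rewrite star_sqrt_iter.
- apply: (cvg_cnorm_le zl); exists 0 => p _.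
  by rewrite (le_trans (sqrt_iter_bound _ y1))//; case/andP: (sqrt_bound_itv p).
- have z2 : z + z = y + z ^+ 2.
    rewrite -mulr2n -scaler_nat zE scalerA -zE.
    rewrite (_ : 2%:R * _ = 1) ?scale1r//.
    by rewrite -(rmorph_nat (real_complex R)) -rmorphM mulfV ?pnatr_eq0.
  rewrite expr2 mulrBl mul1r mulrBr mulr1 -expr2.
  have -> : y = z + z - z ^+ 2 by rewrite z2 addrK.
  by rewrite -addrA -opprD addrA.
- move=> c cy; rewrite /GRing.comm.
  apply: (cvg_cnorm_uniq (cvg_cnormMl c zl)) => e.
  move=> /(cvg_cnormMr c zl)[M Ml]; exists M => p /Ml.
  by rewrite (sqrt_iter_comm _ cy).
Qed.

End SquareRoot.

(** * Positive elements *)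

Section SelfAdjointSquares.
Context (R : realType) (A : cstarAlgType R).
Implicit Types (a b c h k p q x y : A) (t : R).

Lemma scale_realM (s t : R) x :
  (s%:C)%C *: ((t%:C)%C *: x) = ((s * t)%:C)%C *: x.
Proof. by rewrite scalerA -rmorphM. Qed.

Lemma scale_realK t x : t != 0 -> ((t^-1)%:C)%C *: ((t%:C)%C *: x) = x.
Proof. by move=> t0; rewrite scale_realM mulVf// rmorph1 scale1r. Qed.

Lemma scale_realVK t x : t != 0 -> (t%:C)%C *: (((t^-1)%:C)%C *: x) = x.
Proof. by move=> t0; rewrite scale_realM mulfV// rmorph1 scale1r. Qed.

(* [h] is the real part of the unitary [h + ik]. *)
Lemma unit_pair_norm h k : star h = h -> star k = k -> GRing.comm h k ->
  h * h + k * k = 1 -> cnorm h <= 1.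
Proof.
move=> hs ks hk hk1; pose ic : R[i] := 'i%C; pose u := h + ic *: k.
have us : star u = h - ic *: k.
  rewrite starD starZ hs ks -scaleNr; congr (_ + _ *: _).
  by apply/eqP; rewrite eq_complex /= oppr0 !eqxx.
have u1 : cnorm u = 1.
  have : cnorm (star u * u) = 1.
    rewrite us mulrBl !mulrDr -!scalerAl -!scalerAr hk scalerA.
    rewrite (_ : ic * ic = -1); last by rewrite -expr2 sqr_i.
    by rewrite scaleN1r opprD addrA addrK opprK hk1 cnorm1.
  rewrite cnorm_star => /eqP; rewrite sqrp_eq1 ?cnorm_ge0// => /eqP//.
have : cnorm (u + star u) <= 2 by rewrite (le_trans (cnormD _ _))// cnormE u1.
rewrite us addrCA addrK -mulr2n -scaler_nat cnormZ.
rewrite -(rmorph_nat (real_complex R)) normc_real normr_nat.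
by rewrite -[leRHS]mulr1 ler_pM2l.
Qed.

Lemma ball_sqrt a : star a = a -> cnorm (1 - a) <= 1 ->
  exists h, [/\ star h = h, cnorm (1 - h) <= 1, h * h = a &
    forall c, GRing.comm c a -> GRing.comm c h].
Proof.
move=> as_ a1; have [|z [zs z1 zE zc]] := unit_sqrt _ a1.
  by rewrite starB star1 as_.
exists (1 - z); split.
- by rewrite starB star1 zs.
- by rewrite opprB addrCA subrr addr0.
- by rewrite -expr2 zE opprB addrCA subrr addr0.
- move=> c ca; apply: GRing.commrB; first exact: commr1.
  by apply: zc; apply: GRing.commrB => //; exact: commr1.
Qed.

(** [1 - h * h] is within distance 1 of the unit, hence has a root [k] commuting with [h]. Then [k]
    is the real part of the unitary [k + ih], so [k * k] has norm at most 1. *)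
Lemma sqr_ball h : star h = h -> cnorm h <= 1 -> cnorm (1 - h * h) <= 1.
Proof.
move=> hs h1; have hh1 : cnorm (h * h) <= 1.
  by rewrite cnorm_sqr// exprn_ile1// cnorm_ge0.
have [||k [ks _ kE kc]] := @ball_sqrt (1 - h * h).
- by rewrite starB starM star1 hs.
- by rewrite opprB addrCA subrr addr0.
rewrite -kE cnorm_sqr// exprn_ile1 ?cnorm_ge0//.
apply: (@unit_pair_norm k h) => //; last by rewrite kE subrK.
apply/commr_sym/kc; apply: GRing.commrB; first exact: commr1.
exact: GRing.commrM.
Qed.

Definition sqpos a := exists2 h, star h = h & a = h * h.

Lemma sqpos_star a : sqpos a -> star a = a.
Proof. by case=> h hs ->; rewrite starM hs. Qed.

Lemma sqpos0 : sqpos 0.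
Proof. by exists 0; rewrite ?star0// mulr0. Qed.

Lemma sqpos1 : sqpos 1.
Proof. by exists 1; rewrite ?star1// mulr1. Qed.

Lemma sqposZ t a : 0 <= t -> sqpos a -> sqpos ((t%:C)%C *: a).
Proof.
move=> t0 [h hs ->]; exists (((Num.sqrt t)%:C)%C *: h); first by rewrite starZr hs.
by rewrite -scalerAl -scalerAr scale_realM -[Num.sqrt t * _]expr2 sqr_sqrtr.
Qed.

Lemma sqpos_ball a : sqpos a -> cnorm a <= 1 -> cnorm (1 - a) <= 1.
Proof.
case=> h hs ->; rewrite cnorm_sqr// expr_le1 ?cnorm_ge0// => h1.
exact: sqr_ball.
Qed.

Lemma ball_sqpos a : star a = a -> cnorm (1 - a) <= 1 -> sqpos a.
Proof. by move=> as_ /(ball_sqrt as_)[h [hs _ <- _]]; exists h. Qed.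

Lemma cnorm_scaleV t a : 0 < t -> cnorm (((t^-1)%:C)%C *: a) = cnorm a / t.
Proof. by move=> t0; rewrite cnormZr ger0_norm ?invr_ge0 1?ltW// mulrC. Qed.

(** Trades a square root for a norm estimate, which passes through sums, limits and isometric
    homomorphisms, where a root could not be followed. *)
Lemma sqposP t a : 0 < t -> cnorm a <= t ->
  sqpos a <-> star a = a /\ cnorm ((t%:C)%C *: 1 - a) <= t.
Proof.
move=> t0 at_; set b := ((t^-1)%:C)%C *: a.
have b1 : cnorm b <= 1 by rewrite cnorm_scaleV// ler_pdivrMr// mul1r.
have aE : a = (t%:C)%C *: b by rewrite scale_realVK ?gt_eqF.
have -> : cnorm ((t%:C)%C *: 1 - a) = t * cnorm (1 - b).
  by rewrite aE -scalerBr cnormZr gtr0_norm.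
rewrite -[leRHS]mulr1 ler_pM2l//; split => [ap|[as_ ab]].
  split; first exact: sqpos_star.
  by apply: sqpos_ball => //; apply: sqposZ => //; rewrite invr_ge0 ltW.
rewrite aE; apply: sqposZ; first exact: ltW.
by apply: ball_sqpos => //; rewrite starZr as_.
Qed.

Lemma sqpos_sqrt a : sqpos a -> exists h,
  [/\ sqpos h, h * h = a & forall c, GRing.comm c a -> GRing.comm c h].
Proof.
(* The extra 1 keeps [t] invertible when [a = 0]. *)
move=> ap; set t := cnorm a + 1; have t0 : 0 < t by rewrite ltr_wpDl ?cnorm_ge0.
set b := ((t^-1)%:C)%C *: a.
have b1 : cnorm b <= 1.
  by rewrite cnorm_scaleV// ler_pdivrMr// mul1r /t lerDl.
have bp : sqpos b by apply: sqposZ => //; rewrite invr_ge0 ltW.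
have [h [hs h1 hE hc]] := ball_sqrt (sqpos_star bp) (sqpos_ball bp b1).
exists (((Num.sqrt t)%:C)%C *: h); split.
- by apply: sqposZ; [exact: sqrtr_ge0 | exact: ball_sqpos].
- rewrite -scalerAl -scalerAr scale_realM -[Num.sqrt t * _]expr2 sqr_sqrtr ?ltW// hE.
  by rewrite scale_realVK ?gt_eqF.
- by move=> c ca; apply/commrZ/hc/commrZ.
Qed.

Lemma sqposD a b : sqpos a -> sqpos b -> sqpos (a + b).
Proof.
move=> ap bp; set t := cnorm a + cnorm b + 1.
have t0 : 0 < t by rewrite ltr_wpDl// addr_ge0 ?cnorm_ge0.
have at_ : cnorm a <= t by rewrite /t -addrA lerDl addr_ge0 ?cnorm_ge0.
have bt : cnorm b <= t by rewrite /t -addrA addrCA lerDl addr_ge0 ?cnorm_ge0.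
have [as_ a1] := (sqposP t0 at_).1 ap; have [bs b1] := (sqposP t0 bt).1 bp.
apply/(@sqposP (t + t)); first by rewrite addr_gt0.
  by rewrite (le_trans (cnormD _ _)) ?lerD.
split; first by rewrite starD as_ bs.
by rewrite rmorphD scalerDl opprD addrACA (le_trans (cnormD _ _)) ?lerD.
Qed.

Lemma sqpos_sum (I : Type) (r : seq I) (P : pred I) (f : I -> A) :
  (forall i, P i -> sqpos (f i)) -> sqpos (\sum_(k <- r | P k) f k).
Proof. by move=> fp; apply: big_ind => //; [exact: sqpos0 | exact: sqposD]. Qed.

Lemma sqpos_cvg u a : cvg_cnorm u a -> (forall m, sqpos (u m)) -> sqpos a.
Proof.
move=> ua up; set t := cnorm a + 1.
have t0 : 0 < t by rewrite ltr_wpDl ?cnorm_ge0.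
apply/(@sqposP t) => //; first by rewrite lerDl.
split.
  by apply: (cvg_cnorm_uniq (cvg_cnorm_star ua)) => e /ua[M Ml];
    exists M => p /Ml; rewrite sqpos_star.
apply: (cvg_cnorm_le (cvg_cnormD (cvg_cnorm_cst _) (cvg_cnormN ua))).
(* From this index on [u p] has norm at most [cnorm a + 1 = t], so one [t] serves the whole tail in
   [sqposP]. *)
have [M Ml] := ua 1 ltr01; exists M => p /Ml pl.
by apply: ((sqposP t0 _).1 (up p)).2;
  rewrite -(subrK a (u p)) addrC (le_trans (cnormD _ _))// lerD2l ltW.
Qed.

Lemma sqpos_sub1 a : sqpos a -> cnorm a <= 1 -> sqpos (1 - a).
Proof.
move=> ap a1; apply: ball_sqpos; first by rewrite starB star1 sqpos_star.
by rewrite opprB addrCA subrr addr0.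
Qed.

Lemma sqpos_sub a t : sqpos a -> cnorm a <= t -> sqpos ((t%:C)%C *: 1 - a).
Proof.
move=> ap at_; have [t0|] := ltP 0 t.
  rewrite -[a](@scale_realVK t) ?gt_eqF// -scalerBr; apply: sqposZ; first exact: ltW.
  apply: sqpos_sub1; first by apply: sqposZ => //; rewrite invr_ge0 ltW.
  by rewrite cnorm_scaleV// ler_pdivrMr// mul1r.
move=> t0; have a0 : cnorm a = 0.
  by apply/eqP; rewrite eq_le cnorm_ge0 (le_trans at_).
have {}t0 : t = 0 by apply/eqP; rewrite eq_le t0 -a0 at_.
by rewrite (cnorm0_eq0 _ a0) t0 scale0r subrr; exact: sqpos0.
Qed.

(** Write [p = h * h] and [1 - p = k * k] with [k] commuting with [h]; then [h] is the real part of
    the unitary [h + ik]. *)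
Lemma sqpos_norm1 p : sqpos p -> sqpos (1 - p) -> cnorm p <= 1.
Proof.
move=> [h hs pE] /sqpos_sqrt[k [kp kE kc]]; rewrite pE cnorm_sqr//.
rewrite exprn_ile1 ?cnorm_ge0//; apply: (@unit_pair_norm h k) => //.
- exact: sqpos_star.
- apply: kc; apply: GRing.commrB; first exact: commr1.
  by rewrite pE; apply: GRing.commrM.
- by rewrite kE -pE addrC subrK.
Qed.

Lemma sqpos_norm p t : 0 <= t -> sqpos p -> sqpos ((t%:C)%C *: 1 - p) ->
  cnorm p <= t.
Proof.
move=> t0 pp pt; apply/ler_addgt0Pr => e e0; set s := t + e.
have s0 : 0 < s by rewrite ltr_wpDl.
rewrite -[leRHS]mul1r -ler_pdivrMr// -cnorm_scaleV//.
have sV0 : 0 <= s^-1 by rewrite invr_ge0 ltW.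
apply: sqpos_norm1; first exact: sqposZ.
rewrite -[1](@scale_realK s) ?gt_eqF// -scalerBr; apply: sqposZ => //.
rewrite rmorphD scalerDl addrAC; apply: sqposD => //.
by apply: sqposZ; [exact: ltW | exact: sqpos1].
Qed.

Lemma sqpos_normD p q : sqpos p -> sqpos q -> cnorm p <= cnorm (p + q).
Proof.
move=> pp qp; apply: sqpos_norm => //; first exact: cnorm_ge0.
rewrite -[p in X in _ - X](addrK q) opprB addrCA.
by apply: sqposD => //; apply: sqpos_sub => //; exact: sqposD.
Qed.

Lemma sqpos_anti p : sqpos p -> sqpos (- p) -> p = 0.
Proof.
move=> pp np; apply: cnorm_small => e e0.
by rewrite (le_trans (sqpos_normD pp np))// subrr cnorm0 ltW.
Qed.

End SelfAdjointSquares.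

(** * Positivity of [star b * b] and uniqueness of square roots *)

Section Positivity.
Context (R : realType) (A : cstarAlgType R).
Implicit Types (a b c h k l m p q x y : A) (t : R).

Lemma scale_real2 x : ((2%:R : R)%:C)%C *: x = x + x.
Proof. by rewrite rmorph_nat scaler_nat mulr2n. Qed.

Lemma sqpos_half x : sqpos (x + x) -> sqpos x.
Proof.
move=> xp; rewrite -[x](@scale_realK R A 2) ?pnatr_eq0// scale_real2.
by apply: sqposZ => //; rewrite invr_ge0.
Qed.

(** Up to a factor 2 this is the sum of the squares of the self-adjoint elements [x + star x] and
    [i (x - star x)]. *)
Lemma sqpos_symm x : sqpos (x * star x + star x * x).
Proof.
apply: sqpos_half; set y := star x; pose ic : R[i] := 'i%C.
have -> : x * y + y * x + (x * y + y * x) =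
    (x + y) * (x + y) + (ic *: (x - y)) * (ic *: (x - y)).
  rewrite -scalerAl -scalerAr scalerA (_ : ic * ic = -1); last by rewrite -expr2 sqr_i.
  have -> : (x + y) * (x + y) = x * y + y * x + (x * x + y * y).
    by rewrite mulrDl !mulrDr [LHS](AC (2*2) ((2*3)*(1*4))).
  have -> : (x - y) * (x - y) = x * x + y * y - (x * y + y * x).
    by rewrite mulrBl !mulrBr opprB addrACA -opprD.
  by rewrite scaleN1r opprB [RHS]addrACA subrr addr0.
apply: sqposD; first by exists (x + y) => //; rewrite starD [star y]starK addrC.
exists (ic *: (x - y)) => //; rewrite starZ starB [star y]starK -opprB scalerN -scaleNr.
by congr (_ *: _); apply/eqP; rewrite eq_complex /= oppr0 opprK !eqxx.
Qed.

(* Write [x'] for [star x].  With [mu = |x x'| = |m|^2], the identity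
   [(mu - x x') x = x (mu + m^2)] bounds the norm of
   [(mu + m^2) m^2 (mu + m^2) >= 2 mu m^4] by [mu^3], forcing [mu = 0]. *)
Lemma star_mul_neg_sqr x m : star m = m -> star x * x = - (m * m) -> m = 0.
Proof.
move=> ms xm; set a := m * m; have [mu muE] : exists mu, mu = cnorm m ^+ 2 by eexists.
have am : cnorm a = mu by rewrite cnorm_sqr.
have as_ : star a = a by rewrite starM ms.
have x2 : cnorm x ^+ 2 = mu by rewrite -cnorm_star xm cnormN.
have xp : sqpos (x * star x).
  rewrite -[_ * _](addrK (star x * x)) [in X in _ - X]xm opprK.
  by apply: sqposD; [exact: sqpos_symm | exists m].
have [mu0|mu0] := leP mu 0.
  apply: cnorm0_eq0; apply/eqP; rewrite -sqrf_eq0 eq_le -muE mu0.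
  by rewrite muE sqr_ge0.
have xx : cnorm (x * star x) <= mu by rewrite cnorm_starr x2.
have [_ ball] := (sqposP mu0 xx).1 xp.
set u := (mu%:C)%C *: 1 + a.
have wE : ((mu%:C)%C *: 1 - x * star x) * x = x * u.
  by rewrite mulrBl mulrDr -scalerAl -scalerAr mul1r mulr1 -mulrA xm mulrN opprK.
have us : star u = u by rewrite starD starZr star1 as_.
have le1 : cnorm (u * a * u) <= mu ^+ 3.
  have -> : cnorm (u * a * u) = cnorm (x * u) ^+ 2.
    rewrite -cnorm_star -[LHS]cnormN; congr cnorm.
    by rewrite starM us -[RHS]mulrA (mulrA (star x)) xm mulNr mulrN mulrA.
  have -> : mu ^+ 3 = (mu * cnorm x) ^+ 2 by rewrite [RHS]exprMn x2 -exprSr.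
  rewrite -wE lerXn2r ?nnegrE ?mulr_ge0 ?cnorm_ge0 ?(ltW mu0)//.
  by rewrite (le_trans (cnormM _ _))// ler_wpM2r ?cnorm_ge0.
have uau : u * a * u = ((2 * mu)%:C)%C *: (a * a) + (((mu * mu)%:C)%C *: a + a * (a * a)).
  rewrite mulr_natl mulr2n rmorphD scalerDl /u.
  rewrite !(mulrDl, mulrDr) -!scalerAl -!scalerAr !mul1r !mulr1 scale_realM -!mulrA.
  by rewrite [LHS](AC (2*2) ((2*3)*(1*4))).
have a2 : sqpos (a * a) by exists a.
have : cnorm (((2 * mu)%:C)%C *: (a * a)) <= cnorm (u * a * u).
  rewrite uau; apply: sqpos_normD.
    by apply: sqposZ => //; rewrite mulr_ge0// ltW.
  apply: sqposD; first by apply: sqposZ; [rewrite mulr_ge0// ltW | exists m].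
  by exists (m * a); rewrite /a ?starM ?ms !mulrA.
rewrite cnormZr cnorm_sqr// am gtr0_norm ?mulr_gt0// => /le_trans/(_ le1).
rewrite -mulrA -exprS; have := exprn_gt0 3 mu0; set v := mu ^+ 3.
by move=> v0; rewrite mulr_natl mulr2n gerDl leNgt v0.
Qed.

Lemma sqpos_abs a : star a = a -> exists p,
  [/\ sqpos p, p * p = a * a & GRing.comm p a].
Proof.
move=> as_; have [|p [pp pE pc]] := @sqpos_sqrt R A (a * a); first by exists a.
by exists p; split => //; apply/commr_sym/pc/GRing.commrM.
Qed.

Lemma sa_cube_eq0 a : star a = a -> a * a * a = 0 -> a = 0.
Proof.
move=> as_ a3; apply: star_mul_eq0; rewrite as_; apply: star_mul_eq0.
by rewrite starM as_ mulrA a3 mul0r.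
Qed.

(** Here [p] is [|a|], [l = |a| - a] is twice the negative part of [a], and [q] is the root of
    [|a|]. Then [star (b * l) * (b * l) = l * a * l = - (l * q)^2], so [star_mul_neg_sqr] gives
    [l * q = 0]; since [l^3 = 2 (l * q)^2], also [l = 0] and [a = |a|]. *)
Lemma sqpos_starM b : sqpos (star b * b).
Proof.
set a := star b * b; have as_ : star a = a by rewrite starM starK.
have [p [pp pE pa]] := sqpos_abs as_; have ps := sqpos_star pp.
have [l lE] : exists l, l = p - a by eexists.
have ls : star l = l by rewrite lE starB ps as_.
have [q [qp qE qc]] := sqpos_sqrt pp; have qs := sqpos_star qp.
have lp : GRing.comm l p.
  by rewrite lE; apply/commr_sym; apply: GRing.commrB.
have lq : GRing.comm l q by exact: qc.
(* This is [(|a| - a) (|a| + a) = 0], rewritten with [|a| + a = 2 |a| - l]. *)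
have llE : l * l = l * p + l * p.
  rewrite -mulrDr; apply/eqP; rewrite -subr_eq0 -mulrBr.
  have -> : l - (p + p) = - (a + p) by rewrite lE [p - a]addrC opprD addrA addrK opprD.
  by rewrite mulrN oppr_eq0 lE mulrBl !mulrDr pE pa [a * a + _]addrC subrr.
set m := l * q; have ms : star m = m by rewrite starM qs ls -lq.
have mm : l * p * l = m * m by rewrite -qE /m {2}lq !mulrA.
have m0 : m = 0.
  apply: (@star_mul_neg_sqr (b * l)) => //; rewrite starM ls mulrA -(mulrA l).
  have -> : star b * b = p - l by rewrite lE opprB addrCA subrr addr0.
  by rewrite mulrBr mulrBl llE mulrDl opprD addrA subrr add0r mm.
have l0 : l = 0.
  by apply: sa_cube_eq0 => //; rewrite llE mulrDl mm m0 mulr0 addr0.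
by rewrite -(_ : p = a)//; apply/eqP; rewrite -subr_eq0 -lE l0.
Qed.

Lemma positive_eltP a : positive_elt a <-> sqpos a.
Proof.
by split => [[b ->]|[h hs ->]]; [exact: sqpos_starM | exists h; rewrite hs].
Qed.

(** With [d = p - q], commutation gives [d (p + q) = p^2 - q^2 = 0], so the positive elements
    [d p d] and [d q d] have sum 0 and both vanish; hence [d^3 = d p d - d q d = 0]. *)
Lemma sqpos_sqrt_uniq p q : sqpos p -> sqpos q -> GRing.comm p q ->
  p * p = q * q -> p = q.
Proof.
move=> pp qp pq ppqq; have ps := sqpos_star pp; have qs := sqpos_star qp.
set d := p - q; have ds : star d = d by rewrite starB ps qs.
have conj c : sqpos c -> sqpos (d * c * d).
  move=> [h hs ->]; have -> : d * (h * h) * d = star (h * d) * (h * d).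
    by rewrite starM hs ds !mulrA.
  exact: sqpos_starM.
have sum0 : d * p * d + d * q * d = 0.
  rewrite -mulrDl -mulrDr; suff -> : d * (p + q) = 0 by rewrite mul0r.
  by rewrite mulrBl !mulrDr ppqq pq opprD addrA addrK subrr.
have dpd : d * p * d = 0.
  apply: sqpos_anti; first exact: conj.
  by move/eqP: sum0; rewrite addrC addr_eq0 => /eqP <-; exact: conj.
have dqd : d * q * d = 0 by rewrite -sum0 dpd add0r.
apply/eqP; rewrite -subr_eq0; apply/eqP; apply: sa_cube_eq0 => //.
have -> : (p - q) * (p - q) * (p - q) = d * p * d - d * q * d.
  by rewrite -mulrBl -mulrBr.
by rewrite dpd dqd subrr.
Qed.

End Positivity.

(** * Contractivity and isometry of star-homomorphisms *)

Section StarHom.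
Context (R : realType) (A B : cstarAlgType R) (f : A -> B) (fh : star_hom f).

Lemma star_homD x y : f (x + y) = f x + f y.
Proof. exact: (zd_mapD (star_homZD fh)). Qed.

Lemma star_hom0 : f 0 = 0.
Proof. exact: (zd_map0 (star_homZD fh)). Qed.

Lemma star_homZ c x : f (c *: x) = c *: f x.
Proof. exact: (zd_mapZ (star_homZD fh)). Qed.

Lemma star_homB x y : f (x - y) = f x - f y.
Proof. exact: (zd_mapB (star_homZD fh)). Qed.

Lemma star_hom_sum (I : Type) (r : seq I) (P : pred I) (F : I -> A) :
  f (\sum_(k <- r | P k) F k) = \sum_(k <- r | P k) f (F k).
Proof. exact: (zd_map_sum (star_homZD fh)). Qed.

Lemma star_hom_sqpos x : sqpos x -> sqpos (f x).
Proof.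
move=> [h hs ->]; exists (f h); last exact: (star_homM fh).
by rewrite -(star_hom_star fh) hs.
Qed.

(** The inequality [star x * x <= cnorm x ^+ 2] is witnessed by the square of a self-adjoint
    element, and [f] preserves such squares. *)
Lemma star_hom_le x : cnorm (f x) <= cnorm x.
Proof.
rewrite -(@ler_pXn2r _ 2)// ?nnegrE ?cnorm_ge0// -cnorm_star.
apply: sqpos_norm; first exact: sqr_ge0.
  exact: sqpos_starM.
have := @sqpos_sub _ _ (star x * x) (cnorm x ^+ 2) (sqpos_starM _).
rewrite cnorm_star lexx => /(_ isT)/star_hom_sqpos.
by rewrite star_homB star_homZ (star_hom1 fh) (star_homM fh) (star_hom_star fh).
Qed.

Lemma star_hom_lip x y : cnorm (f x - f y) <= cnorm (x - y).
Proof. by rewrite -star_homB star_hom_le. Qed.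

(* With [r = |f a|], uniqueness of square roots gives [f |r - a| = r - f a],
   so that injectivity of [f] yields [|r - a| = r - a], that is [a <= r]. *)
Lemma star_hom_isometric : injective f -> forall x, cnorm (f x) = cnorm x.
Proof.
move=> fi x; apply/eqP; rewrite eq_le star_hom_le /=.
rewrite -(@ler_pXn2r _ 2)// ?nnegrE ?cnorm_ge0// -!cnorm_star.
rewrite -(star_hom_star fh) -(star_homM fh); set a := star x * x.
have ap : sqpos a := sqpos_starM x.
set r := cnorm (f a); set c := (r%:C)%C *: 1 - a.
have cs : star c = c by rewrite starB starZr star1 (sqpos_star ap).
have [p [pp pE pc]] := sqpos_abs cs.
have fc : sqpos (f c).
  rewrite star_homB star_homZ (star_hom1 fh); apply: sqpos_sub => //.
  exact: star_hom_sqpos.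
have pcE : p = c.
  apply: fi; apply: sqpos_sqrt_uniq => //; first exact: star_hom_sqpos.
    by rewrite /GRing.comm -!(star_homM fh) pc.
  by rewrite -!(star_homM fh) pE.
apply: sqpos_norm => //; first exact: cnorm_ge0.
by rewrite -/r -/c -pcE.
Qed.

End StarHom.

(** * Closed subalgebras of the Cuntz algebra *)

Definition cnorm_closed (R : realType) (A : cstarAlgType R) (P : A -> Prop) :=
  forall x, (forall e : R, 0 < e -> exists2 y, P y & cnorm (x - y) < e) -> P x.

Section ClosedSubalgebra.
Context (R : realType) (O : cstarAlgType R).

(** Bundled because universality ranges over C*-algebras: the subset must itself become a
    [cstarAlgType] to be a target. Closedness supplies completeness. *)
Record cstar_sub := CStarSub {
  cstar_sub_set :> O -> Prop;
  cstar_sub1 : cstar_sub_set 1;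
  cstar_subZD : forall (c : R[i]) x y,
    cstar_sub_set x -> cstar_sub_set y -> cstar_sub_set (c *: x + y);
  cstar_subM : forall x y,
    cstar_sub_set x -> cstar_sub_set y -> cstar_sub_set (x * y);
  cstar_sub_star : forall x, cstar_sub_set x -> cstar_sub_set (star x);
  cstar_sub_closed : cnorm_closed cstar_sub_set
}.

Variable C : cstar_sub.

Definition cstar_sub_pred : {pred O} := fun x => `[< C x >].

Lemma cstar_sub_subalg : subalg_closed cstar_sub_pred.
Proof.
split=> [|c x y /asboolP xC /asboolP yC|x y /asboolP xC /asboolP yC];
  apply/asboolP; [exact: cstar_sub1 | exact: cstar_subZD | exact: cstar_subM].
Qed.

HB.instance Definition _ :=
  GRing.isSubalgClosed.Build R[i] O cstar_sub_pred cstar_sub_subalg.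

Definition cstar_sub_type := {x : O | cstar_sub_pred x}.
HB.instance Definition _ :=
  [isSub of cstar_sub_type for (@sval O (fun x => cstar_sub_pred x))].
HB.instance Definition _ := [Choice of cstar_sub_type by <:].
HB.instance Definition _ := [SubChoice_isSubAlgebra of cstar_sub_type by <:].

Implicit Types x y : cstar_sub_type.

Lemma cstar_subP x : C (val x).
Proof. exact/asboolP/(valP x). Qed.

Definition cstar_sub_star_op x : cstar_sub_type :=
  exist (fun z => cstar_sub_pred z) (star (val x))
    (asboolT (cstar_sub_star (cstar_subP x))).

Lemma cstar_sub_complete :
  complete_for (fun x : cstar_sub_type => cnorm (val x)).
Proof.
move=> u uc; have [l ul] : exists l, cvg_cnorm (fun p => val (u p)) l.
  apply: (@cnorm_complete R O) => e /uc[M Mu]; exists M => p q Mp Mq.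
  by have := Mu p q Mp Mq; rewrite raddfB.
have lC : C l.
  apply: cstar_sub_closed => e e0; have [M Ml] := ul e e0.
  by exists (val (u M)); [exact: cstar_subP | rewrite cnormC Ml].
exists (exist (fun z => cstar_sub_pred z) l (asboolT lC)) => e /ul[M Ml].
by exists M => p /Ml; rewrite raddfB.
Qed.

Fact cstar_sub_starK : involutive cstar_sub_star_op.
Proof. by move=> x; apply: val_inj; exact: starK. Qed.
Fact cstar_sub_starD : {morph cstar_sub_star_op : x y / x + y}.
Proof.
move=> x y; apply: val_inj; rewrite [RHS]raddfD -[RHS]starD.
by congr star; exact: raddfD.
Qed.
Fact cstar_sub_starZ (c : R[i]) x :
  cstar_sub_star_op (c *: x) = (c^*)%R *: cstar_sub_star_op x.
Proof.
apply: val_inj; rewrite [RHS]linearZ -[RHS]starZ.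
by congr star; exact: linearZ.
Qed.
Fact cstar_sub_starM x y :
  cstar_sub_star_op (x * y) = cstar_sub_star_op y * cstar_sub_star_op x.
Proof.
apply: val_inj; rewrite [RHS]rmorphM -[RHS]starM.
by congr star; exact: rmorphM.
Qed.
Fact cstar_sub_normD x y : cnorm (val (x + y)) <= cnorm (val x) + cnorm (val y).
Proof. by rewrite raddfD cnormD. Qed.
Fact cstar_sub_normZ (c : R[i]) x :
  cnorm (val (c *: x)) = Normc.normc c * cnorm (val x).
Proof. by rewrite linearZ cnormZ. Qed.
Fact cstar_sub_norm0_eq0 x : cnorm (val x) = 0 -> x = 0.
Proof. by move=> /cnorm0_eq0 x0; apply: val_inj; rewrite x0 raddf0. Qed.
Fact cstar_sub_normM x y : cnorm (val (x * y)) <= cnorm (val x) * cnorm (val y).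
Proof. by rewrite rmorphM cnormM. Qed.
Fact cstar_sub_norm_star x :
  cnorm (val (cstar_sub_star_op x * x)) = cnorm (val x) ^+ 2.
Proof. by rewrite rmorphM cnorm_star. Qed.

HB.instance Definition _ := isCStar.Build R cstar_sub_type
  cstar_sub_starK cstar_sub_starD cstar_sub_starZ cstar_sub_starM
  cstar_sub_normD cstar_sub_normZ cstar_sub_norm0_eq0 cstar_sub_normM
  cstar_sub_norm_star cstar_sub_complete.

Lemma cstar_sub_val_hom : star_hom (val : cstar_sub_type -> O).
Proof. by split=> [c x y|x y||x]; rewrite ?linearP ?rmorphM ?rmorph1. Qed.

End ClosedSubalgebra.

(** Universality maps [O] to [C]. Followed by the inclusion, this is an endomorphism of [O] fixing
    the generators, hence the identity by uniqueness, and its values lie in [C]. *)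
Lemma cuntz_subalgebra (R : realType) (n : nat) (O : cstarAlgType R)
    (s : 'I_n -> O) (cuntzO : is_cuntz_algebra s) (C : cstar_sub O) :
  (forall i, C (s i)) -> forall x, C x.
Proof.
move=> Cs x; have [rel univ] := cuntzO.
pose t i : cstar_sub_type C :=
  exist (fun z => cstar_sub_pred C z) (s i) (asboolT (Cs i)).
have [|f [[fh ft] _]] := univ (cstar_sub_type C) t.
  case: rel => rel1 rel2; split=> [i j|]; apply: val_inj.
    by rewrite [LHS]rmorphM [RHS]rmorph_nat; exact: rel1.
  rewrite raddf_sum rmorph1 -rel2; apply: eq_bigr => i _.
  exact: rmorphM.
have [h [_ hu]] := univ O s rel.
have -> : x = val (f x).
  transitivity (h x).
    by rewrite (hu id).
  rewrite (hu (val \o f))//; split; last by move=> i /=; rewrite ft.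
  have vh := cstar_sub_val_hom C.
  split=> [c y z|y z||y] /=.
  - by rewrite (star_homZD fh) (star_homZD vh).
  - by rewrite (star_homM fh) (star_homM vh).
  - by rewrite (star_hom1 fh) (star_hom1 vh).
  - by rewrite (star_hom_star fh) (star_hom_star vh).
exact: cstar_subP.
Qed.

(** * Norm-continuous maps and closed predicates *)

Section Continuity.
Context (R : realType).

Definition cnorm_continuous (A B : cstarAlgType R) (f : A -> B) :=
  forall x (e : R), 0 < e -> exists2 h : R, 0 < h &
    forall y, cnorm (x - y) < h -> cnorm (f x - f y) < e.

Lemma lip_continuous (A B : cstarAlgType R) (f : A -> B) (K : R) :
  (forall x y, cnorm (f x - f y) <= K * cnorm (x - y)) -> cnorm_continuous f.
Proof.
move=> fK x e e0; have K0 : 0 < `|K| + 1 by rewrite ltr_wpDl.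
exists (e / (`|K| + 1)) => [|y]; first by rewrite divr_gt0.
rewrite ltr_pdivlMr// => le; apply: le_lt_trans le.
rewrite (le_trans (fK _ _))// mulrC ler_wpM2l ?cnorm_ge0//.
by rewrite (le_trans (ler_norm K))// lerDl.
Qed.

Lemma star_hom_continuous (A B : cstarAlgType R) (f : A -> B) :
  star_hom f -> cnorm_continuous f.
Proof.
by move=> fh; apply: (@lip_continuous _ _ _ 1) => x y; rewrite mul1r star_hom_lip.
Qed.

Lemma cst_continuous (A B : cstarAlgType R) (b : B) :
  cnorm_continuous (fun _ : A => b).
Proof. by move=> x e e0; exists 1 => // y _; rewrite subrr cnorm0. Qed.

Lemma comp_continuous (A B D : cstarAlgType R) (f : B -> D) (g : A -> B) :
  cnorm_continuous f -> cnorm_continuous g -> cnorm_continuous (fun x => f (g x)).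
Proof.
move=> fc gc x e e0; have [h h0 hf] := fc (g x) e e0.
by have [h' h'0 hg] := gc x h h0; exists h' => // y /hg/hf.
Qed.

Lemma star_continuous (A : cstarAlgType R) : cnorm_continuous (@star R A).
Proof. by apply: (@lip_continuous _ _ _ 1) => x y; rewrite mul1r -starB cnormE. Qed.

Lemma scale_continuous (A : cstarAlgType R) c :
  cnorm_continuous (fun x : A => c *: x).
Proof.
by apply: (@lip_continuous _ _ _ (Normc.normc c)) => x y; rewrite -scalerBr cnormZ.
Qed.

Lemma mull_continuous (A : cstarAlgType R) (a : A) :
  cnorm_continuous (fun x => a * x).
Proof.
by apply: (@lip_continuous _ _ _ (cnorm a)) => x y; rewrite -mulrBr cnormM.
Qed.

Lemma mulr_continuous (A : cstarAlgType R) (a : A) :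
  cnorm_continuous (fun x => x * a).
Proof.
by apply: (@lip_continuous _ _ _ (cnorm a)) => x y; rewrite -mulrBl mulrC cnormM.
Qed.

Lemma closed_preimage (A B : cstarAlgType R) (f : A -> B) (P : B -> Prop) :
  cnorm_continuous f -> cnorm_closed P -> cnorm_closed (fun x => P (f x)).
Proof.
move=> fc Pc x xP; apply: Pc => e e0; have [h h0 hf] := fc x e e0.
by have [y Py xy] := xP h h0; exists (f y) => //; exact: hf.
Qed.

Lemma closed_eq (A B : cstarAlgType R) (f g : A -> B) :
  cnorm_continuous f -> cnorm_continuous g -> cnorm_closed (fun x => f x = g x).
Proof.
move=> fc gc x xP; apply/eqP; rewrite -subr_eq0; apply/eqP/cnorm_small => e e0.
have e2 : 0 < e / 2 by rewrite divr_gt0.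
have [h h0 hf] := fc x _ e2; have [h' h'0 hg] := gc x _ e2.
have [|y yE] := xP (Num.min h h'); first by rewrite lt_min h0.
rewrite lt_min => /andP[/hf xf /hg xg].
rewrite (le_trans (cnorm_tri _ (f y) _))// [e]splitr lerD ?ltW//.
by rewrite yE cnormC.
Qed.

End Continuity.

(** * Induction on degree in the Cuntz algebra *)

Section GradedFamily.
Context (R : realType) (n : nat) (O : cstarAlgType R) (s : 'I_n -> O).
Hypothesis cuntzO : is_cuntz_algebra s.

(** What makes the span of the [S k] a unital star-subalgebra containing the generators. The
    instances are the gauge spectral subspaces, the ranges of the [e k], and the elements that the
    homomorphism into the crossed product sends to their counterparts. *)
Record graded_family (S : int -> O -> Prop) : Prop := GradedFamily {
  gradedZD : forall k (c : R[i]) x y, S k x -> S k y -> S k (c *: x + y);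
  gradedM : forall k l x y, S k x -> S l y -> S (k + l) (x * y);
  graded_star : forall k x, S k x -> S (- k) (star x);
  graded1 : S 0 1;
  graded_gen : forall i, S 1 (s i)
}.

Record closed_additive (P : O -> Prop) : Prop := ClosedAdditive {
  cladd_closed : cnorm_closed P;
  cladd0 : P 0;
  claddD : forall x y, P x -> P y -> P (x + y)
}.

Lemma closed_additive_preimage (f : O -> O) (P : O -> Prop) :
  cnorm_continuous f -> {morph f : x y / x + y} -> closed_additive P ->
  closed_additive (fun x => P (f x)).
Proof.
move=> fc fD [Pc P0 PD]; split; first exact: closed_preimage.
  suff -> : f 0 = 0 by [].
  by apply: (addrI (f 0)); rewrite -fD !addr0.
by move=> x y fx fy; rewrite fD; exact: PD.
Qed.

(** [hull] is the smallest closed additive predicate containing every [S k]. Taking preimages under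
    continuous additive maps shows that it is stable under scalars, products and [star], so
    [cuntz_subalgebra] applies to it. *)
Lemma graded_total (S : int -> O -> Prop) (P : O -> Prop) : graded_family S ->
  closed_additive P -> (forall k x, S k x -> P x) -> forall x, P x.
Proof.
move=> gS; pose hull x := forall Q, closed_additive Q ->
  (forall k y, S k y -> Q y) -> Q x.
suff hullT x : hull x by move=> Pca SP x; exact: (hullT x).
have hullS k y : S k y -> hull y by move=> Sy Q _ SQ; exact: SQ Sy.
have hull_ca : closed_additive hull.
  split=> [y hy Q Qca SQ|Q [_ //]|y z hy hz Q Qca SQ]; last first.
    by apply: (claddD Qca); [exact: hy | exact: hz].
  by apply: (cladd_closed Qca) => e /hy[z hz yz]; exists z => //; exact: hz.
have hull_pre (f : O -> O) : cnorm_continuous f -> {morph f : x y / x + y} ->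
    (forall k y, S k y -> hull (f y)) -> forall y, hull y -> hull (f y).
  by move=> fc fD fS y hy; apply: (hy (fun z => hull (f z))) => //;
    exact: closed_additive_preimage.
have hullZ (c : R[i]) y : hull y -> hull (c *: y).
  apply: (hull_pre (fun y => c *: y)).
  - exact: scale_continuous.
  - exact: scalerDr.
  (* A graded family has no clause for 0, so [c *: z] is written as [c *: z + (- z + z)]. *)
  - move=> k z Sz; apply: (hullS k); rewrite -[_ *: z]addr0 -[X in _ + X](addNr z).
    by apply: (gradedZD gS) => //; rewrite -scaleN1r; exact: (gradedZD gS).
have hullM y z : hull y -> hull z -> hull (y * z).
  (* Two inductions on the hull: [z] varies against a fixed [y], then [y] against a fixed
     homogeneous [z]. *)
  move=> hy; move: z; apply: (hull_pre (fun z => y * z)).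
  - exact: mull_continuous.
  - exact: mulrDr.
  - move=> k z Sz; move: y hy; apply: (hull_pre (fun y => y * z)).
    + exact: mulr_continuous.
    + by move=> u v; rewrite mulrDl.
    + by move=> l y Sy; apply: (hullS (l + k)); exact: (gradedM gS).
have hull_star y : hull y -> hull (star y).
  apply: hull_pre; [exact: star_continuous | exact: starD |].
  by move=> k z Sz; apply: (hullS (- k)); exact: (graded_star gS).
have [hc h0 hD] := hull_ca.
have hullZD (c : R[i]) y z : hull y -> hull z -> hull (c *: y + z).
  by move=> hy hz; apply: hD => //; exact: hullZ.
pose C := CStarSub (hullS _ _ (graded1 gS)) hullZD hullM hull_star hc.
by apply: (@cuntz_subalgebra _ _ _ _ cuntzO C) => i; exact: hullS (graded_gen gS i).
Qed.

End GradedFamily.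

(** * The gauge expectation *)

Section CircleExp.
Context (R : realType).
Local Notation w := (@circle_exp R).

Lemma circle_expD (s t : R) : w (s + t) = w s * w t.
Proof.
apply/eqP; rewrite eq_complex /= mulrDr cosD sinD.
by rewrite eqxx /= addrC [cos _ * sin _ + _]addrC addrC eqxx.
Qed.

Lemma circle_exp0 : w 0 = 1.
Proof. by rewrite /circle_exp mulr0 cos0 sin0. Qed.

Lemma circle_exp_half : w (2^-1) = -1.
Proof.
rewrite /circle_exp mulrAC mulfV ?pnatr_eq0// mul1r cospi sinpi.
by apply/eqP; rewrite eq_complex /= oppr0 !eqxx.
Qed.

Lemma circle_exp_norm (t : R) : `|w t| = 1.
Proof. by rewrite normc_def /= cos2Dsin2 sqrtr1. Qed.

Lemma circle_exp_neq0 (t : R) : w t != 0.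
Proof. by rewrite -normr_gt0 circle_exp_norm ltr01. Qed.

Lemma circle_expX (t : R) (m : nat) : w (m%:R * t) = w t ^+ m.
Proof.
elim: m => [|m IH]; first by rewrite mul0r circle_exp0.
by rewrite exprS -IH -circle_expD -natr1 mulrDl mul1r addrC.
Qed.

Lemma circle_expZ (t : R) (k : int) : w (k%:~R * t) = w t ^ k.
Proof.
case: k => m; first exact: circle_expX.
rewrite NegzE -exprnN mulrNz mulNr -circle_expX.
set u := _ * t; apply: (mulIf (circle_exp_neq0 u)).
by rewrite mulVf ?circle_exp_neq0// -circle_expD addNr circle_exp0.
Qed.

Lemma normc_circle_expB1 (t : R) :
  Normc.normc (w t - 1) = Num.sqrt (2 * (1 - cos (2 * pi * t))).
Proof.
rewrite /= oppr0 addr0; congr Num.sqrt; have := cos2Dsin2 (2 * pi * t).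
by set c := cos _; set d := sin _ => cd; lra.
Qed.

Lemma circle_exp_continuous0 (e : R) : 0 < e -> exists2 h : R, 0 < h &
  forall t, `|t| < h -> Normc.normc (w t - 1) < e.
Proof.
(* The distance to 1 is the root of [2 (1 - cos (2 pi t))], so [1 - cos] has to stay below
   [e ^+ 2 / 2]. *)
move=> e0; have e2 : 0 < e ^+ 2 / 2 by rewrite divr_gt0 ?exprn_gt0.
have := @continuous_cos R 0; rewrite /continuous_at cos0 => /cvgrPdist_lt/(_ _ e2).
move=> /nbhs_ballP[r r0 rP]; have pi2 : 0 < 2 * pi :> R by rewrite mulr_gt0 ?pi_gt0.
exists (r / (2 * pi)); first by rewrite divr_gt0.
move=> t; rewrite ltr_pdivlMr// => tr; rewrite normc_circle_expB1.
have /rP /= : ball (0 : R) r (2 * pi * t).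
  by rewrite /ball /= sub0r normrN normrM gtr0_norm// mulrC.
move=> /(le_lt_trans (ler_norm _)) cosr.
have := cos_le1 (2 * pi * t); set c := cos _ in cosr *; move=> c1.
rewrite -(@ltr_pXn2r _ 2)// ?nnegrE ?sqrtr_ge0//; last exact: ltW.
by rewrite sqr_sqrtr; lra.
Qed.

End CircleExp.

(** By [sqposP], positivity is self-adjointness plus a norm estimate, both readable after an
    isometric homomorphism. This brings positivity of [E (star x * x)] from [O] back to [A]. *)
Lemma star_hom_sqpos_reflect (R : realType) (A B : cstarAlgType R) (f : A -> B)
    (fh : star_hom f) (fn : forall a, cnorm (f a) = cnorm a) a :
  sqpos (f a) -> sqpos a.
Proof.
set t := cnorm a + 1; have t0 : 0 < t by rewrite ltr_wpDl ?cnorm_ge0.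
have at_ : cnorm a <= t by rewrite lerDl.
have fi x : f x = 0 -> x = 0 by move=> x0; apply: cnorm0_eq0; rewrite -fn x0 cnorm0.
have ft : cnorm (f a) <= t by rewrite fn.
move=> /(sqposP t0 ft)[fs fb]; apply/(sqposP t0 at_); split.
  by apply/eqP; rewrite -subr_eq0; apply/eqP/fi; rewrite (star_homB fh) (star_hom_star fh) fs subrr.
by rewrite -fn (star_homB fh) (star_homZ fh) (star_hom1 fh).
Qed.

(** * Averages over gauge orbits *)

Section GaugeAverage.
Context (R : realType) (n : nat) (O : cstarAlgType R) (s : 'I_n -> O).
Hypothesis cuntzO : is_cuntz_algebra s.
Context (g : R[i] -> O -> O).
Hypothesis gaugeO : is_gauge_action s g.
Context (A : cstarAlgType R) (i : A -> O).
Hypothesis fixA : is_gauge_fixed_algebra g i.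
Context (E : O -> A).
Hypothesis averageE : is_gauge_average g i E.
Local Notation w := (@circle_exp R).

Lemma gauge_hom z : `|z| = 1 -> star_hom (g z).
Proof. by move=> /(gauge_iso gaugeO)[]. Qed.

Let wh t : star_hom (g (w t)) := gauge_hom (circle_exp_norm t).

Lemma fix_hom : star_hom i.
Proof. by case: fixA => -[]. Qed.

Lemma fix_norm a : cnorm (i a) = cnorm a.
Proof. by case: fixA => -[_ +] _; exact. Qed.

Lemma fix_inj : injective i.
Proof.
move=> a b ab; apply/eqP; rewrite -subr_eq0; apply/eqP; apply: cnorm0_eq0.
by rewrite -fix_norm (star_homB fix_hom) ab subrr cnorm0.
Qed.

Lemma gauge_fix z a : `|z| = 1 -> g z (i a) = i a.
Proof.
move=> z1; have [_ rng] := fixA.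
have : range i (i a) by exists a.
by rewrite rng; exact.
Qed.

Lemma fix_preimage x : (forall z, `|z| = 1 -> g z x = x) -> exists a, i a = x.
Proof.
move=> xg; have [_ rng] := fixA.
have : range i x by rewrite rng.
by case=> a _ <-; exists a.
Qed.

(** The left Riemann sum with mesh [1/m], that is the average of the orbit over the [m]-th roots of
    unity. Linearity, the bimodule property, contractivity and positivity of [E] pass from these
    sums to the limit. *)
Definition riemann_avg (m : nat) (x : O) : O :=
  \sum_(k < m) ((m%:R^-1)%:C)%C *: g (w (k%:R / m%:R)) x.

Lemma riemann_avg_cvg x : cvg_cnorm (fun m => riemann_avg m x) (i (E x)).
Proof.
move=> e e0; have [d d0 dP] := averageE x e0.
exists (Num.truncn d^-1).+1 => m Mm.
have m0 : (0 < m)%N by exact: leq_ltn_trans Mm.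
have mR0 : 0 < m%:R :> R by rewrite ltr0n.
have step k : k.+1%:R / m%:R - k%:R / m%:R = m%:R^-1 :> R.
  by rewrite -mulrBl -natr1 addrAC subrr add0r mul1r.
have md : m%:R^-1 < d.
  rewrite invf_plt ?posrE//; apply: lt_le_trans (_ : (Num.truncn d^-1).+1%:R <= _).
    exact: truncnS_gt.
  by rewrite ler_nat.
have := dP m (fun k => k%:R / m%:R) (fun k => k%:R / m%:R).
rewrite mul0r divff ?gt_eqF// => /(_ erefl erefl) H.
rewrite /riemann_avg (eq_bigr (fun k : 'I_m => (((k.+1)%:R / m%:R - k%:R / m%:R)%:C)%C
  *: g (w (k%:R / m%:R)) x)); last by move=> k _; rewrite step.
by apply: H => k km; rewrite lexx -subr_ge0 !step invr_ge0 ltW.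
Qed.

Lemma riemann_avgZD m (c : R[i]) x y :
  riemann_avg m (c *: x + y) = c *: riemann_avg m x + riemann_avg m y.
Proof.
rewrite /riemann_avg scaler_sumr -big_split/=; apply: eq_bigr => k _.
by rewrite (star_homZD (wh _)) scalerDr !scalerA mulrC.
Qed.

Lemma sum_inv_scale m (x : O) : (0 < m)%N ->
  \sum_(k < m) ((m%:R^-1)%:C)%C *: x = x.
Proof.
move=> m0; rewrite sumr_const card_ord -scaler_nat scalerA.
rewrite -(rmorph_nat (real_complex R)) -rmorphM mulfV ?rmorph1 ?scale1r//.
by rewrite pnatr_eq0 -lt0n.
Qed.

Lemma riemann_avg_bimod m a x b :
  riemann_avg m (i a * x * i b) = i a * riemann_avg m x * i b.
Proof.
rewrite /riemann_avg mulr_sumr mulr_suml; apply: eq_bigr => k _.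
rewrite !(star_homM (wh _)) !gauge_fix ?circle_exp_norm//.
by rewrite -scalerAr -scalerAl.
Qed.

Lemma riemann_avg_norm m x : cnorm (riemann_avg m x) <= cnorm x.
Proof.
rewrite (le_trans (cnorm_sum _ _ _))//.
have [->|m0] := posnP m; first by rewrite big_ord0 cnorm_ge0.
apply: (@le_trans _ _ (\sum_(k < m) m%:R^-1 * cnorm x)).
  apply: ler_sum => k _; rewrite cnormZr ger0_norm ?invr_ge0//.
  by rewrite ler_wpM2l ?invr_ge0// star_hom_le.
rewrite sumr_const card_ord -[X in X <= _]mulr_natl mulrA mulfV ?mul1r//.
by rewrite pnatr_eq0 -lt0n.
Qed.

Lemma expectationZD (c : R[i]) x y : E (c *: x + y) = c *: E x + E y.
Proof.
apply: fix_inj; rewrite (star_homZD fix_hom).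
apply: (cvg_cnorm_uniq (riemann_avg_cvg _)).
move=> e /(cvg_cnormD (cvg_cnormZ c (riemann_avg_cvg x)) (riemann_avg_cvg y))[M Ml].
by exists M => p /Ml; rewrite riemann_avgZD.
Qed.

Lemma expectationD x y : E (x + y) = E x + E y.
Proof. exact: (zd_mapD expectationZD). Qed.

Lemma expectation0 : E 0 = 0.
Proof. exact: (zd_map0 expectationZD). Qed.

Lemma expectationZ c x : E (c *: x) = c *: E x.
Proof. exact: (zd_mapZ expectationZD). Qed.

Lemma expectationB x y : E (x - y) = E x - E y.
Proof. exact: (zd_mapB expectationZD). Qed.

Lemma expectation_sum (I : Type) (r : seq I) (P : pred I) (F : I -> O) :
  E (\sum_(k <- r | P k) F k) = \sum_(k <- r | P k) E (F k).
Proof. exact: (zd_map_sum expectationZD). Qed.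

Lemma expectation_fix a : E (i a) = a.
Proof.
apply: fix_inj; apply: (cvg_cnorm_uniq (riemann_avg_cvg _)) => e e0.
exists 1 => m m0; rewrite /riemann_avg.
under eq_bigr => k _ do rewrite gauge_fix ?circle_exp_norm//.
by rewrite sum_inv_scale// subrr cnorm0.
Qed.

Lemma expectation_bimod a x b : E (i a * x * i b) = a * E x * b.
Proof.
apply: fix_inj; rewrite !(star_homM fix_hom).
apply: (cvg_cnorm_uniq (riemann_avg_cvg _)).
move=> e /(cvg_cnormMr (i b) (cvg_cnormMl (i a) (riemann_avg_cvg x)))[M Ml].
by exists M => p /Ml; rewrite riemann_avg_bimod.
Qed.

Lemma expectationMl a x : E (i a * x) = a * E x.
Proof. by rewrite -[X in E X]mulr1 -(star_hom1 fix_hom) expectation_bimod mulr1. Qed.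

Lemma expectationMr x b : E (x * i b) = E x * b.
Proof. by rewrite -[x in LHS]mul1r -(star_hom1 fix_hom) expectation_bimod mul1r. Qed.

Lemma expectation_norm x : cnorm (E x) <= cnorm x.
Proof.
rewrite -fix_norm; apply: (cvg_cnorm_le (riemann_avg_cvg x)).
by exists 0 => p _; exact: riemann_avg_norm.
Qed.

Lemma expectation_continuous : cnorm_continuous E.
Proof.
apply: (@lip_continuous _ _ _ _ 1) => x y.
by rewrite mul1r -expectationB expectation_norm.
Qed.

Lemma expectation_sqpos x : sqpos (E (star x * x)).
Proof.
apply: (star_hom_sqpos_reflect fix_hom fix_norm).
apply: (sqpos_cvg (riemann_avg_cvg _)) => m; apply: sqpos_sum => k _.
apply: sqposZ; first by rewrite invr_ge0.
by apply: (star_hom_sqpos (wh _)); exact: sqpos_starM.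
Qed.

Definition homogeneous (k : int) (x : O) : Prop :=
  forall z : R[i], `|z| = 1 -> g z x = z ^ k *: x.

Lemma homogeneous_graded : graded_family s homogeneous.
Proof.
split=> [k c x y xk yk z z1|k l x y xk yk z z1|k x xk z z1|z z1|j z z1].
- by rewrite (star_homZD (gauge_hom z1)) xk// yk// scalerDr !scalerA mulrC.
- rewrite (star_homM (gauge_hom z1)) xk// yk// -scalerAl -scalerAr scalerA.
  by rewrite expfzDr// -normr_gt0 z1 ltr01.
- rewrite (star_hom_star (gauge_hom z1)) xk// starZ; congr (_ *: _).
  rewrite fmorphXz -exprz_inv; congr (_ ^ _).
  have z0 : z != 0 by rewrite -normr_gt0 z1 ltr01.
  apply: (mulfI z0); rewrite mulfV//.
  by rewrite -normCK z1 expr1n.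
- by rewrite (star_hom1 (gauge_hom z1)) expr0z scale1r.
- by rewrite (gauge_gen gaugeO)// expr1z.
Qed.

Lemma homogeneous0P x : homogeneous 0 x <-> exists a, i a = x.
Proof.
split=> [x0|[a <-] z z1]; last by rewrite gauge_fix// scale1r.
by apply: fix_preimage => z z1; rewrite x0// scale1r.
Qed.

(** The number of points is chosen so that [z], the [k]-th power of [circle_exp (1/m)], has
    [z ^+ M = -1], a half turn. Hence [z != 1] and [z ^+ m = 1], and the geometric sum vanishes. *)
Lemma riemann_avg_homogeneous k x M : homogeneous k x -> k != 0 -> (0 < M)%N ->
  riemann_avg (2 * `|k| * M) x = 0.
Proof.
move=> xk k0 M0; set m := (2 * `|k| * M)%N.
have m0 : m%:R != 0 :> R.
  by rewrite pnatr_eq0 !muln_eq0 /= absz_eq0 (negbTE k0) -lt0n.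
set z := w m%:R^-1 ^ k.
have E1 (l : 'I_m) : ((m%:R^-1)%:C)%C *: g (w (l%:R / m%:R)) x =
    z ^+ l *: (((m%:R^-1)%:C)%C *: x).
  rewrite xk ?circle_exp_norm// !scalerA mulrC; congr (_ * _ *: _).
  by rewrite circle_expX /z !exprnP exprzAC.
rewrite /riemann_avg (eq_bigr _ (fun l _ => E1 l)) -scaler_suml.
have half : w m%:R^-1 ^+ (`|k| * M) = -1.
  rewrite -circle_expX -circle_exp_half; congr circle_exp.
  apply: (mulIf m0); rewrite mulfVK// /m -mulnA [in RHS]natrM mulrA.
  by rewrite mulVf ?mul1r ?pnatr_eq0.
have zM : z ^+ M = -1.
  rewrite /z; clear E1 z; move: half; case: (k) => l.
    by rewrite -exprnP -exprM.
  by rewrite NegzE -exprnN exprVn -exprM => ->; rewrite invrN1.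
have z1 : z - 1 != 0.
  rewrite subr_eq0; apply/eqP => zE; move/eqP: zM.
  by rewrite zE expr1n -subr_eq0 opprK -(natrD _ 1 1) pnatr_eq0.
suff -> : \sum_(l < m) z ^+ l = 0 by rewrite scale0r.
apply: (mulfI z1); rewrite mulr0 -subrX1 /m mulnC !exprM zM.
by rewrite sqrrN expr1n expr1n subrr.
Qed.

Lemma expectation_homogeneous k x : homogeneous k x -> k != 0 -> E x = 0.
Proof.
move=> xk k0; apply: cnorm_small => e e0; rewrite -fix_norm.
have [M Ml] := riemann_avg_cvg x e0.
(* The limit may be tested along indices where the sums vanish; [M.+1] makes this one positive and
   at least [M]. *)
have := Ml (2 * `|k| * M.+1)%N; rewrite riemann_avg_homogeneous//.
rewrite sub0r cnormN => /(_ _)/ltW; apply.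
by rewrite (leq_trans (leqnSn M))// leq_pmull// muln_gt0 absz_gt0 k0.
Qed.

(** In degree [k] the orbit is [circle_exp (k t) *: x], continuous at 0; contractivity of each
    [g z], uniform in [z], carries this to limits. *)
Lemma gauge_orbit_continuous x (e : R) : 0 < e -> exists2 h : R, 0 < h &
  forall t, `|t| < h -> cnorm (g (w t) x - x) < e.
Proof.
move: x e; pose P x := forall e : R, 0 < e -> exists2 h : R, 0 < h &
  forall t, `|t| < h -> cnorm (g (w t) x - x) < e.
suff : forall x, P x by [].
apply: (graded_total cuntzO homogeneous_graded) => [|k x xk e e0]; last first.
  have c0 : 0 < cnorm x + 1 by rewrite ltr_wpDl ?cnorm_ge0.
  have [h h0 hP] := circle_exp_continuous0 (divr_gt0 e0 c0).
  (* The orbit depends on [k t]; adding 1 avoids a division by 0 in degree 0. *)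
  exists (h / (`|k|%:R + 1)); first by rewrite divr_gt0// ltr_wpDl ?ler0n.
  move=> t; rewrite ltr_pdivlMr ?ltr_wpDl ?ler0n// => th.
  have {}/hP : `|k%:~R * t| < h.
    apply: le_lt_trans th; rewrite normrM mulrC ler_wpM2l// -intr_norm.
    by rewrite -abszE -pmulrn lerDl.
  rewrite xk ?circle_exp_norm// -[X in _ *: x - X]scale1r -scalerBl cnormZ.
  rewrite -circle_expZ ltr_pdivlMr//; apply: le_lt_trans.
  rewrite ler_wpM2l//; first by rewrite normc_circle_expB1 sqrtr_ge0.
  by rewrite lerDl.
split=> [x xP e e0|e e0|x y xP yP e e0].
- have e3 : 0 < e / 3%:R by rewrite divr_gt0.
  have [y yP xy] := xP _ e3; have [h h0 hP] := yP _ e3.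
  exists h => // t /hP th.
  have -> : g (w t) x - x = g (w t) (x - y) + (g (w t) y - y) + (y - x).
    by rewrite (star_homB (wh t)) !addrA !subrK.
  rewrite (le_lt_trans (cnormD _ _))// (_ : e = e / 3%:R + e / 3%:R + e / 3%:R); last by field.
  rewrite ltrD// 1?cnormC// (le_lt_trans (cnormD _ _))// ltrD//.
  exact: le_lt_trans (star_hom_le (wh t) _) xy.
- by exists 1 => // t _; rewrite (star_hom0 (wh t)) subrr cnorm0.
- have e2 : 0 < e / 2 by rewrite divr_gt0.
  have [h h0 hP] := xP _ e2; have [h' h'0 h'P] := yP _ e2.
  exists (Num.min h h'); first by rewrite lt_min h0.
  move=> t; rewrite lt_min => /andP[/hP tx /h'P ty].
  by rewrite (star_homD (wh t)) opprD addrACA (le_lt_trans (cnormD _ _))// [e]splitr ltrD.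
Qed.

(* On the arc [0 <= t < 1/q], where the orbit of [P] stays close to [P], the
   Riemann sums of the orbit are close to [P/q]; being part of a sum of positive
   elements that tends to [0], they are small. *)
Lemma expectation_faithful x : E (star x * x) = 0 -> x = 0.
Proof.
set P := star x * x => EP; suff: P = 0 by exact: star_mul_eq0.
apply: cnorm_small => e e0; have e2 : 0 < e / 2 by rewrite divr_gt0.
have [h h0 hP] := gauge_orbit_continuous P e2.
pose q := (Num.truncn h^-1).+1.
have q0 : 0 < q%:R :> R by rewrite ltr0n.
have qh : q%:R^-1 < h by rewrite invf_plt ?posrE// truncnS_gt.
(* The first [M] terms will sum to within [e / 2 / q] of both 0 and [P / q]; multiplying by [q]
   leaves [e]. *)
have eq0 : 0 < e / 2 / q%:R by rewrite divr_gt0.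
have [M0 M0P] := riemann_avg_cvg P eq0; pose M := M0.+1.
have Mpos : 0 < M%:R :> R by rewrite ltr0n.
have := M0P (q * M)%N; rewrite EP (star_hom0 fix_hom) subr0.
have -> : (M0 <= q * M)%N by rewrite (leq_trans (leqnSn M0))// leq_pmull.
move=> /(_ isT).
have -> : (q * M = M + (Num.truncn h^-1) * M)%N by rewrite mulSn.
set m := (M + _)%N.
have mE : m%:R = q%:R * M%:R :> R by rewrite -natrM /m /q mulSn.
have m0 : 0 < m%:R :> R by rewrite mE mulr_gt0.
rewrite /riemann_avg big_split_ord/=.
set head := \sum_(k < M) _; set tail := \sum_(k < _) _ => avg_small.
have summand_pos (k : nat) : sqpos (((m%:R^-1)%:C)%C *: g (w (k%:R / m%:R)) P).
  apply: sqposZ; first by rewrite invr_ge0 ltW.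
  by apply: (star_hom_sqpos (wh _)); exact: sqpos_starM.
have head_small : cnorm head < e / 2 / q%:R.
  apply: le_lt_trans avg_small; apply: sqpos_normD;
  by apply: sqpos_sum => k _; exact: summand_pos.
have head_close : cnorm (((q%:R^-1)%:C)%C *: P - head) <= e / 2 / q%:R.
  have -> : ((q%:R^-1)%:C)%C *: P = \sum_(k < M) ((m%:R^-1)%:C)%C *: P.
    rewrite sumr_const card_ord -[RHS]scaler_nat -(rmorph_nat (real_complex R)) scale_realM.
    by rewrite mE invfM mulrCA mulfV ?mulr1// gt_eqF.
  rewrite -sumrB (le_trans (cnorm_sum _ _ _))//.
  apply: (@le_trans _ _ (\sum_(k < M) m%:R^-1 * (e / 2))).
    apply: ler_sum => k _; rewrite -scalerBr cnormZr gtr0_norm ?invr_gt0//.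
    rewrite ler_pM2l ?invr_gt0// cnormC ltW//; apply: hP.
    rewrite ger0_norm ?divr_ge0 ?ler0n//; apply: lt_trans qh.
    by rewrite mE invfM mulrCA gtr_pMr ?invr_gt0// ltr_pdivrMr// mul1r ltr_nat.
  rewrite sumr_const card_ord -[X in X <= _]mulr_natl mE.
  rewrite [leLHS](_ : _ = e / 2 / q%:R)//; field.
  by rewrite !gt_eqF.
have : cnorm (((q%:R^-1)%:C)%C *: P) <= e / q%:R.
  rewrite -[X in cnorm X](subrK head) (le_trans (cnormD _ _))//.
  by rewrite [e]splitr mulrDl lerD// ltW.
by rewrite cnorm_scaleV// ler_pM2r ?invr_gt0.
Qed.

Lemma expectation_is_faithful : faithful_expectation i E.
Proof.
split.
- exact: expectationZD.
- exact: expectation_fix.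
- exact: expectation_bimod.
- by move=> x; apply/positive_eltP/expectation_sqpos.
- exact: expectation_faithful.
Qed.

End GaugeAverage.

(** * Bimodules and functors *)

Section HilbertBimodules.
Context (R : realType) (A : cstarAlgType R).

Lemma rip_suml (Y : bimod_data A) (HY : is_right_hilbert Y) (I : Type)
    (r : seq I) (P : pred I) (G : I -> Y) y :
  ⟨\sum_(k <- r | P k) G k | y⟩ = \sum_(k <- r | P k) ⟨G k | y⟩.
Proof.
have D0 : ⟨0 | y⟩ = 0.
  rewrite -(rip_star HY) (_ : ⟨y | 0⟩ = 0) ?star0//.
  by apply: (addrI ⟨y | 0⟩); rewrite -(ripDr HY) !addr0.
have Dl (a b : Y) : ⟨a + b | y⟩ = ⟨a | y⟩ + ⟨b | y⟩.
  by rewrite -(rip_star HY) (ripDr HY) starD !(rip_star HY).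
exact: (big_morph (fun x : Y => ⟨x | y⟩) Dl D0).
Qed.

Lemma rip_sumr (Y : bimod_data A) (HY : is_right_hilbert Y) (I : Type)
    (r : seq I) (P : pred I) (G : I -> Y) y :
  ⟨y | \sum_(k <- r | P k) G k⟩ = \sum_(k <- r | P k) ⟨y | G k⟩.
Proof.
rewrite -(rip_star HY) rip_suml// star_sum; apply: eq_bigr => k _.
exact: rip_star.
Qed.

Lemma ripMl (Y : bimod_data A) (HY : is_right_hilbert Y) (x y : Y) a :
  ⟨x ◁ a | y⟩ = star a * ⟨x | y⟩.
Proof. by rewrite -(rip_star HY) (ripMr HY) starM (rip_star HY). Qed.

(* The adjoint of [h] is [y |-> \sum_k u_k <h u_k | y>], for a right
   Pimsner-Popa basis [u]. *)
Lemma fgp_adjointable (X Y : bim_fgp A) (h : X -> Y) :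
  (forall (c : R[i]) x y, h (c *: x + y) = c *: h x + h y) ->
  (forall a x, h (x ◁ a) = h x ◁ a) ->
  exists h' : Y -> X, forall x y, ⟨h x | y⟩ = ⟨x | h' y⟩.
Proof.
move=> hZD hR; have [m [u uE]] := bim_rbasis (bimP X).
have HX := bim_right (bimP X); have HY := bim_right (bimP Y).
exists (fun y => \sum_k u k ◁ ⟨h (u k) | y⟩) => x y.
rewrite (rip_sumr HX) [in LHS](uE x) (zd_map_sum hZD) (rip_suml HY).
apply: eq_bigr => k _.
by rewrite hR (ripMl HY) (ripMr HX) (rip_star HX).
Qed.

End HilbertBimodules.

(** * Finite direct sums of lines *)

Section GradedHilbert.
Context (C : numClosedFieldType).

Lemma ghom_ext (H K : ghilb) (f f' : ghom C H K) :
  (forall a b, f a b = f' a b) -> f = f'.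
Proof.
case: f f' => [m mP] [m' m'P] /= mm'.
have {}mm' : m = m' by apply/funext => a; apply/funext => b.
by subst m'; congr GHom; exact: Prop_irrelevance.
Qed.

Fact gincl_subproof (K : {fset int}) (p : K) (a : K) (b : unit) :
  val a != val p -> (a == p)%:R = 0 :> C.
Proof. by case: (a =P p) => [->|//]; rewrite eqxx. Qed.

(** The direct sum of the lines with degrees in [K]; [F] turns it into a ready-made direct sum of
    the bimodules [F (gline k)]. *)
Definition gsum (K : {fset int}) : ghilb := @GHilb K val.

Definition gincl (K : {fset int}) (p : K) : ghom C (gline (val p)) (gsum K) :=
  @GHom C (gline (val p)) (gsum K) _ (@gincl_subproof K p).

End GradedHilbert.

Section FunctorFacts.
Context (R : realType) (A : cstarAlgType R) (F : utfunctor A).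

Lemma fmorZD (H K : ghilb) (f : ghom R[i] H K) (c : R[i]) (x y : F H) :
  fmor F f (c *: x + y) = c *: fmor F f x + fmor F f y.
Proof. exact: bim_morZD (fmorP F f) _ _ _. Qed.

Lemma fmor_zero (H K : ghilb) (f : ghom R[i] H K) :
  (forall a b, f a b = 0) -> forall x : F H, fmor F f x = 0.
Proof.
move=> f0 x; have {1}-> : f = glin (-1) f f.
  by apply: ghom_ext => a b; rewrite /= f0 mulr0 addr0.
by rewrite fmor_lin scaleN1r addNr.
Qed.

(** With [fmor_gline_neq], this is Schur's lemma for the lines seen through [F]; full faithfulness
    extends it to all bimodule maps between their images. *)
Lemma fmor_gline_scale (k : int) (f : ghom R[i] (gline k) (gline k)) :
  forall x : F (gline k), fmor F f x = f tt tt *: x.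
Proof.
move=> x; set c := f tt tt.
pose o : ghom R[i] (gline k) (gline k) := glin (-1) (gid _ _) (gid _ _).
have o0 (y : F (gline k)) : fmor F o y = 0.
  by apply: fmor_zero => a b; rewrite /= mulN1r addNr.
have -> : f = glin c (gid _ _) o.
  by apply: ghom_ext => -[] [] /=; rewrite ?eqxx mulr1 mulN1r addNr addr0.
by rewrite fmor_lin fmor_id o0 addr0.
Qed.

Lemma fmor_gline_neq (k l : int) (f : ghom R[i] (gline k) (gline l)) :
  k != l -> forall x : F (gline k), fmor F f x = 0.
Proof. by move=> kl; apply: fmor_zero => a b; rewrite gmatP// eq_sym. Qed.

Context (K : {fset int}).
Local Notation inc p := (fmor F (gincl R[i] p)).
Local Notation prj p := (fmor F (gadj (gincl R[i] p))).

Lemma prj_adj (p : K) (x : F (gsum K)) y : ⟨prj p x | y⟩ = ⟨x | inc p y⟩.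
Proof.
rewrite fmor_adj; congr (⟨_ | fmor F _ _⟩).
by apply: ghom_ext => a b /=; rewrite conjCK.
Qed.

Lemma prj_inc (p : K) (x : F (gline (val p))) : prj p (inc p x) = x.
Proof.
rewrite -fmor_comp fmor_gline_scale /= (bigD1 p)//= eqxx big1 => [|q qp].
  by rewrite conjC1 mulr1 addr0 scale1r.
by rewrite (negbTE qp) mulr0.
Qed.

Lemma prj_inc_neq (p q : K) (x : F (gline (val p))) : p != q ->
  prj q (inc p x) = 0.
Proof.
by move=> pq; rewrite -fmor_comp fmor_gline_neq// (inj_eq val_inj).
Qed.

Lemma sum_inc_prj (x : F (gsum K)) : \sum_(p : K) inc p (prj p x) = x.
Proof.
(* The matrix of the projection onto the degrees listed in [r]. As [fmor_lin] adds two morphisms at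
   a time, the identity is reached by induction over these projections. *)
pose P (r : seq K) (a b : K) : R[i] := ((a == b) && (a \in r))%:R.
have PP r (a b : gidx (gsum K)) : gdeg a != gdeg b -> P r a b = 0.
  by rewrite /P; case: (a =P b) => [->|//]; rewrite eqxx.
pose Q r : ghom R[i] (gsum K) (gsum K) := GHom (@PP r).
have sumE (r : seq K) : uniq r -> \sum_(p <- r) inc p (prj p x) = fmor F (Q r) x.
  elim: r => [_|p r IH /= /andP[pr ur]].
    by rewrite big_nil fmor_zero// => a b; rewrite /= /P in_nil andbF.
  rewrite big_cons IH// -fmor_comp -[X in X + _]scale1r -fmor_lin.
  congr (fmor F _ x); apply: ghom_ext => a b; rewrite /= (bigD1 tt)//= big1 => [|[]//].
  rewrite addr0 mul1r /P in_cons conjC_nat -natrM -natrD; congr (_%:R).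
  case: (a =P p) => [->|_]; last by rewrite mul0n add0n.
  by rewrite (negbTE pr) andbF addn0 mul1n andbT eq_sym.
rewrite -big_enum sumE ?enum_uniq//.
rewrite -[RHS]fmor_id; congr (fmor F _ x); apply: ghom_ext => a b.
by rewrite /= /P mem_enum andbT.
Qed.

End FunctorFacts.

(** * The inclusion of the fixed-point algebra *)

Section Zembed.
Local Open Scope classical_set_scope.
Context (R : realType) (A : cstarAlgType R) (F : utfunctor A).
Context (B : cstarAlgType R) (h : forall k : int, F (gline k) -> B).
Arguments h : clear implicits.
Hypothesis hZD : forall k (c : R[i]) x y, h k (c *: x + y) = c *: h k x + h k y.
Arguments hZD : clear implicits.

Lemma zembedE (K : {fset int}) (x : zfam F) :
  (forall k, x k != 0 -> k \in K) -> zembed h x = \sum_(k <- K) h k (x k).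
Proof.
move=> xK; rewrite /zembed (@fsbigE _ _ _ _ _ K) ?fset_uniq//.
  by apply: eq_bigl => k; rewrite in_setT.
move=> k _ kK; have [->|/xK] := eqVneq (x k) 0; first exact: (zd_map0 (hZD k)).
by rewrite (negbTE kK).
Qed.

Lemma finsuppP (x : zfam F) :
  finsupp x <-> exists K : {fset int}, forall k, x k != 0 -> k \in K.
Proof.
split=> [xf|[K xK]].
  by exists (fset_set [set k | x k != 0]) => k xk; rewrite in_fset_set// inE.
by apply: (sub_finite_set _ (finite_fset K)) => k /xK.
Qed.

Lemma zembed_add (x y : zfam F) : finsupp x -> finsupp y ->
  finsupp (fun k => x k + y k) /\
  zembed h (fun k => x k + y k) = zembed h x + zembed h y.
Proof.
move=> /finsuppP[K xK] /finsuppP[L yL]; pose KL := (K `|` L)%fset.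
have xKL k : x k != 0 -> k \in KL by move=> /xK kK; rewrite inE kK.
have yKL k : y k != 0 -> k \in KL by move=> /yL kL; rewrite inE kL orbT.
have xyKL k : x k + y k != 0 -> k \in KL.
  have [x0|/xKL//] := eqVneq (x k) 0; have [y0|/yKL//] := eqVneq (y k) 0.
  by rewrite x0 y0 addr0 eqxx.
split; first by apply/finsuppP; exists KL.
rewrite (zembedE xKL) (zembedE yKL) (zembedE xyKL) -big_split/=.
by apply: eq_bigr => k _; rewrite (zd_mapD (hZD k)).
Qed.

Definition zfam0 : zfam F := fun k => 0.
Definition zsingle (k : int) (x : F (gline k)) : zfam F := eqtype.dfwith zfam0 x.

Lemma zembed0 : finsupp zfam0 /\ zembed h zfam0 = 0.
Proof.
have z0 k : zfam0 k != 0 -> k \in fset0 by rewrite eqxx.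
split; first by apply/finsuppP; exists fset0.
by rewrite (zembedE z0) big_seq_fset0.
Qed.

Lemma zembed_single k (x : F (gline k)) :
  finsupp (zsingle x) /\ zembed h (zsingle x) = h k x.
Proof.
have zk l : zsingle x l != 0 -> l \in [fset k]%fset.
  rewrite inE; apply: contraNT => lk; rewrite /zsingle dfwith_out//.
  by rewrite eq_sym.
split; first by apply/finsuppP; exists [fset k]%fset.
by rewrite (zembedE zk) big_seq_fset1 /zsingle dfwith_in.
Qed.

End Zembed.

(** * Spectral subspaces, irreducibility and discreteness *)

Section GaugeFunctor.
Context (R : realType) (n : nat) (O : cstarAlgType R) (s : 'I_n -> O).
Hypothesis cuntzO : is_cuntz_algebra s.
Context (g : R[i] -> O -> O).
Hypothesis gaugeO : is_gauge_action s g.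
Context (A : cstarAlgType R) (i : A -> O).
Hypothesis fixA : is_gauge_fixed_algebra g i.
Context (E : O -> A).
Hypothesis averageE : is_gauge_average g i E.
Context (F : utfunctor A) (e : forall k : int, F (gline k) -> O) (o : 'I_n).
Arguments e : clear implicits.
Hypothesis gaugeF : is_gauge_functor i (s o) e.

Let ih := fix_hom fixA.
Let eZD k := idwZD (gf_ob gaugeF k).
Arguments eZD : clear implicits.

(** Every element of a spectral bimodule is a product of an element of [A] and a power of [s o] or
    of its adjoint. *)
Lemma graded_spectral (S : int -> O -> Prop) : graded_family s S ->
  (forall a, S 0 (i a)) -> forall k y, spectral_bimodule i (s o) k y -> S k y.
Proof.
move=> gS Si; have SX m : S m%:Z (s o ^+ m).
  elim: m => [|m IH]; first exact: (graded1 gS).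
  by rewrite exprS intS; apply: (gradedM gS) => //; exact: (graded_gen gS).
case=> m y [a _ <-].
  by rewrite -[m%:Z]add0r; apply: (gradedM gS).
rewrite NegzE -[- _]addr0; apply: (gradedM gS) => //.
by rewrite -starX; apply: (graded_star gS).
Qed.

Lemma ob_spectral k x : spectral_bimodule i (s o) k (e k x).
Proof.
have : range (e k) (e k x) by exists x.
by rewrite (idw_range (gf_ob gaugeF k)).
Qed.

Lemma spectral_ob k y : spectral_bimodule i (s o) k y -> exists x, e k x = y.
Proof.
rewrite -(idw_range (gf_ob gaugeF k)) => -[x _ <-]; by exists x.
Qed.

Lemma ob_homogeneous k x : homogeneous g k (e k x).
Proof.
apply: (graded_spectral (homogeneous_graded gaugeO)) (ob_spectral x) => a.
by apply/(homogeneous0P fixA); exists a.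
Qed.

Lemma ob_fun0 x : exists a, x = fun0 F a.
Proof. by have [h _ hK] := fun0_bij F; exists (h x); rewrite hK. Qed.

Lemma gprodE k l m (x : F (gline k)) (y : F (gline l)) : m = k + l ->
  e m (gprod m x y) = e k x * e l y.
Proof. by move=> ->; exact: (gf_mul gaugeF). Qed.

Lemma ob_star k x : exists y, e (- k) y = star (e k x).
Proof.
(* Degree 0 is separate because [- 0] is again a [Posz], so [A] stays on the left; in the other
   degrees it changes sides. *)
apply: spectral_ob; have := ob_spectral x; case: k x => [[|m]|m] x [a _ <-].
- by exists (star a) => //; rewrite !expr0 !mulr1 (star_hom_star ih).
- by exists (star a) => //; rewrite starM starX (star_hom_star ih).
- exists (star a) => //.
  by rewrite starM starX starK (star_hom_star ih).
Qed.

Definition ob_range (k : int) (y : O) : Prop := exists x, e k x = y.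

Lemma ob_range_graded : graded_family s ob_range.
Proof.
split=> [k c _ _ [x <-] [y <-]|k l _ _ [x <-] [y <-]|k _ [x <-]||l].
- by exists (c *: x + y); rewrite eZD.
- by exists (gprod (k + l) x y); rewrite gprodE.
- exact: ob_star.
- by exists (fun0 F 1); rewrite (gf_unit gaugeF) (star_hom1 ih).
(* The bimodules involve [s o] alone; any other generator is [s l = (s l * star (s o)) * s o], with
   a gauge-invariant coefficient. *)
- apply: spectral_ob => /=; have [rel _] := cuntzO.
  have hom : homogeneous g 0 (s l * star (s o)).
    have gH := homogeneous_graded gaugeO.
    rewrite -[0](subrr 1); apply: (gradedM gH); first exact: (graded_gen gH).
    by apply: (graded_star gH); exact: (graded_gen gH).
  have [a ia] := (homogeneous0P fixA _).1 hom.
  exists a => //; rewrite ia expr1 -mulrA (cuntz_isom rel) eqxx mulr1//.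
Qed.

Lemma zembed_dense (y : O) (eps : R) : 0 < eps ->
  exists x : zfam F, finsupp x /\ cnorm (y - zembed e x) < eps.
Proof.
move: y eps; pose P y := forall eps : R, 0 < eps ->
  exists x : zfam F, finsupp x /\ cnorm (y - zembed e x) < eps.
suff : forall y, P y by [].
apply: (graded_total cuntzO ob_range_graded); last first.
  move=> k _ [x <-] eps eps0; have [xf xE] := zembed_single eZD x.
  by exists (zsingle x); rewrite xE subrr cnorm0.
split=> [y yP eps eps0|eps eps0|y z yP zP eps eps0].
- have eps2 : 0 < eps / 2 by rewrite divr_gt0.
  have [z zP yz] := yP _ eps2; have [x [xf zx]] := zP _ eps2.
  exists x; split=> //; rewrite (le_lt_trans (cnorm_tri _ z _))//.
  by rewrite [eps]splitr ltrD.
- have [zf zE] := zembed0 eZD.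
  by exists (zfam0 F); rewrite zE subrr cnorm0.
- have eps2 : 0 < eps / 2 by rewrite divr_gt0.
  have [x [xf yx]] := yP _ eps2; have [x' [x'f zx]] := zP _ eps2.
  have [xxf xxE] := zembed_add eZD xf x'f.
  exists (fun k => x k + x' k); split=> //.
  by rewrite xxE opprD addrACA (le_lt_trans (cnormD _ _))// [eps]splitr ltrD.
Qed.

Lemma expectation_ob0 x : i (E (e 0 x)) = e 0 x.
Proof.
have [a ->] := ob_fun0 x.
by rewrite (gf_unit gaugeF) (expectation_fix fixA averageE).
Qed.

Lemma expectation_ob k x : k != 0 -> E (e k x) = 0.
Proof. exact: (expectation_homogeneous fixA averageE (ob_homogeneous x)). Qed.

Lemma expectation_zembed (x : zfam F) : finsupp x ->
  fun0 F (E (zembed e x)) = x 0.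
Proof.
(* Degree 0 is added so that its term can be split off even when [x 0 = 0]. *)
move=> /finsuppP[K xK]; pose L := (0 |` K)%fset.
have xL k : x k != 0 -> k \in L by move=> /xK kK; rewrite !inE kK orbT.
apply: (idw_inj (gf_ob gaugeF 0)); rewrite (gf_unit gaugeF) (zembedE eZD xL).
rewrite (expectation_sum gaugeO fixA averageE) (star_hom_sum ih).
rewrite (bigD1_seq 0) ?fset_uniq ?inE ?eqxx//= expectation_ob0.
by rewrite big1 ?addr0// => k k0; rewrite expectation_ob// (star_hom0 ih).
Qed.

Lemma commutant_expectation (ffF : fully_faithful F) b :
  (forall a, i a * b = b * i a) ->
  exists c : R[i], E b = c *: 1 /\ forall k x, k != 0 -> E (b * e k x) = 0.
Proof.
move=> bA; pose T k (x : F (gline k)) : F (gline 0) := fun0 F (E (b * e k x)).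
have TZD k (c : R[i]) x y : T k (c *: x + y) = c *: T k x + T k y.
  rewrite /T eZD mulrDr -scalerAr (expectationZD gaugeO fixA averageE).
  exact: fun0ZD.
have TR k a x : T k (x ◁ a) = T k x ◁ a.
  rewrite /T (idwR (gf_ob gaugeF k)) mulrA (expectationMr gaugeO fixA averageE).
  exact: fun0R.
have Tmor k : bim_morphism (T k).
  split; [exact: TZD | | exact: TR | exact: fgp_adjointable].
  (* Left linearity is where [b] commuting with [A] enters. *)
  move=> a x; rewrite /T (idwL (gf_ob gaugeF k)) mulrA -bA -mulrA.
  by rewrite (expectationMl gaugeO fixA averageE); exact: fun0L.
have fun0_inj : injective (fun0 F) by apply: bij_inj; exact: fun0_bij.
have fun00 : fun0 F 0 = 0 by apply: zd_map0 => c x y; exact: fun0ZD.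
have [f fE] := (ffF (gline 0) (gline 0)).2 _ (Tmor 0).
exists (f tt tt); split=> [|k x k0]; apply: fun0_inj.
  have := congr1 (fun t => t (fun0 F 1)) fE; rewrite /= fmor_gline_scale.
  rewrite /T (gf_unit gaugeF) (star_hom1 ih) mulr1 => <-.
  by rewrite (zd_mapZ (@fun0ZD _ _ F)).
have [f' f'E] := (ffF (gline k) (gline 0)).2 _ (Tmor k).
by have := congr1 (fun t => t x) f'E; rewrite /= fmor_gline_neq// fun00 /T => ->.
Qed.

(** For [d = b - c], the map [y |-> E (d * y)] vanishes in every degree, hence on [O]. At
    [y = star d], faithfulness of [E] gives [d = 0]. *)
Lemma cuntz_irreducible (ffF : fully_faithful F) : irreducible_inclusion i.
Proof.
move=> b bA; have [c [Eb Ebk]] := commutant_expectation ffF bA.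
exists c; apply/eqP; rewrite -subr_eq0; apply/eqP; set d := b - _.
have [EZ EB] := (expectationZ gaugeO fixA averageE, expectationB gaugeO fixA averageE).
have Ed y : E (d * y) = 0.
  move: y; apply: (graded_total cuntzO ob_range_graded); last first.
    move=> k _ [x <-]; rewrite /d mulrBl EB -scalerAl mul1r EZ.
    have [k0|k0] := eqVneq k 0; last first.
      by rewrite Ebk// expectation_ob// scaler0 subrr.
    subst k; have [a ->] := ob_fun0 x; rewrite (gf_unit gaugeF).
    rewrite (expectationMr gaugeO fixA averageE) (expectation_fix fixA averageE).
    by rewrite Eb -scalerAl mul1r subrr.
  split=> [||x y Ex Ey].
  - apply: closed_eq; last exact: cst_continuous.
    apply: comp_continuous (mull_continuous d).
    exact: (expectation_continuous gaugeO fixA averageE).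
  - by rewrite mulr0 (expectation0 gaugeO fixA averageE).
  - by rewrite mulrDr (expectationD gaugeO fixA averageE) Ex Ey addr0.
have := Ed (star d); rewrite -[X in X * star d]starK.
move=> /(expectation_faithful cuntzO gaugeO fixA averageE) ds.
by rewrite -[d]starK ds star0.
Qed.

(** The single object [F (gsum K)] carries all components of [x]. Different degrees are orthogonal
    for [E (star y * z)], the product having nonzero degree, so the sum of the embeddings preserves
    inner products and is injective. *)
Lemma zembed_PQN (x : zfam F) : finsupp x -> PQN i E (zembed e x).
Proof.
move=> /finsuppP[K xK]; pose X := F (gsum K).
pose prj (p : K) (y : X) : F (gline (val p)) := fmor F (gadj (gincl R[i] p)) y.
pose f (y : X) : O := \sum_(p : K) e (val p) (prj p y).
have fZD (c : R[i]) y z : f (c *: y + z) = c *: f y + f z.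
  rewrite /f scaler_sumr -big_split/=; apply: eq_bigr => p _.
  by rewrite /prj fmorZD eZD.
have ipE (y z : X) : ⟨y | z⟩ = E (star (f y) * f z).
  have HX := bim_right (bimP X).
  rewrite -[z in LHS]sum_inc_prj (rip_sumr HX) star_sum mulr_suml.
  rewrite (expectation_sum gaugeO fixA averageE); apply: eq_bigr => p _.
  rewrite mulr_sumr (expectation_sum gaugeO fixA averageE) (bigD1 p)//= big1.
    by rewrite addr0 -(idw_rip (gf_ob gaugeF _)) (expectation_fix fixA averageE) prj_adj.
  move=> q qp; have gH := homogeneous_graded gaugeO.
  apply: (expectation_homogeneous fixA averageE (k := - val p + val q)).
    apply: (gradedM gH); last exact: ob_homogeneous.
    by apply: (graded_star gH); exact: ob_homogeneous.
  by rewrite addrC subr_eq0 (inj_eq val_inj).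
exists X, f; split=> //.
- move=> a y; rewrite /f mulr_sumr; apply: eq_bigr => p _.
  by rewrite /prj (bim_morL (fmorP F _)) (idwL (gf_ob gaugeF _)).
- move=> a y; rewrite /f mulr_suml; apply: eq_bigr => p _.
  by rewrite /prj (bim_morR (fmorP F _)) (idwR (gf_ob gaugeF _)).
- split=> // y z yz; apply/eqP; rewrite -subr_eq0; apply/eqP.
  apply: (rip_def (bim_right (bimP X))).
  by rewrite ipE (zd_mapB fZD) yz subrr mulr0 (expectation0 gaugeO fixA averageE).
exists (\sum_(p : K) fmor F (gincl R[i] p) (x (val p))).
rewrite (zembedE eZD xK) big_seq_fsetE/= /f; apply: eq_bigr => p _; congr (e _ _).
rewrite /prj (zd_map_sum (fmorZD _)) (bigD1 p)//= prj_inc big1 ?addr0// => q qp.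
exact: prj_inc_neq.
Qed.

Lemma cuntz_irreducible_cdiscrete (ffF : fully_faithful F) :
  irreducible_cdiscrete i E.
Proof.
split.
- by case: fixA.
- exact: (expectation_is_faithful cuntzO gaugeO fixA averageE).
- exact: cuntz_irreducible.
- move=> y eps /(zembed_dense y)[x [xf yx]].
  by exists (zembed e x) => //; exact: zembed_PQN.
Qed.

End GaugeFunctor.

(** * The crossed product *)

Section Transport.
Context (R : realType) (A B D : cstarAlgType R).
Context (i : A -> B) (E : B -> A) (i' : A -> D) (E' : D -> A) (f : B -> D).
Hypothesis iso : inclusion_iso i E i' E' f.

Lemma irreducible_cdiscrete_iso :
  irreducible_cdiscrete i E -> irreducible_cdiscrete i' E'.
Proof.
case: iso => -[fh [h fK hK]] fi fE [[ih inorm] [EZD Ei Ebi Epos Ef] irr disc].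
have fn : forall x, cnorm (f x) = cnorm x.
  by apply: star_hom_isometric => //; exact: can_inj fK.
have E'h d : E' d = E (h d) by rewrite -fE hK.
have h_hom : star_hom h.
  have finj := can_inj fK.
  split=> [c x y|x y||x]; apply: finj.
  - by rewrite hK (star_homZD fh) !hK.
  - by rewrite hK (star_homM fh) !hK.
  - by rewrite hK (star_hom1 fh).
  - by rewrite hK (star_hom_star fh) hK.
have hi a : h (i' a) = i a by rewrite -fi fK.
split.
- split=> [|a]; last by rewrite -fi fn.
  split=> [c x y|x y||x]; rewrite -!fi.
  + by rewrite (star_homZD ih) (star_homZD fh).
  + by rewrite (star_homM ih) (star_homM fh).
  + by rewrite (star_hom1 ih) (star_hom1 fh).
  + by rewrite (star_hom_star ih) (star_hom_star fh).
- split=> [c x y|a|a x b|x|x].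
  + by rewrite !E'h (star_homZD h_hom).
  + by rewrite -fi fE.
  + by rewrite !E'h !(star_homM h_hom) !hi Ebi.
  + by rewrite E'h (star_homM h_hom) (star_hom_star h_hom).
  + rewrite E'h (star_homM h_hom) (star_hom_star h_hom) => /Ef hx.
    by rewrite -[x]hK hx (star_hom0 fh).
- move=> d dA; have [a|c hc] := irr (h d).
    by rewrite -hi -!(star_homM h_hom) dA.
  by exists c; rewrite -[d]hK hc (star_homZ fh) (star_hom1 fh).
- move=> d eps eps0.
  have [b [X [p [pZD pL pR [pinj pip] [x xb]]]] db] := disc (h d) eps eps0.
  exists (f b); last by rewrite -[d]hK -(star_homB fh) fn.
  exists X, (f \o p); split=> /=.
  + by move=> c y z; rewrite pZD (star_homZD fh).
  + by move=> a y; rewrite pL (star_homM fh) fi.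
  + by move=> a y; rewrite pR (star_homM fh) fi.
  + split=> [|y z]; first by apply: inj_comp => //; exact: can_inj fK.
    by rewrite pip -(star_hom_star fh) -(star_homM fh) fE.
  + by exists x; rewrite xb.
Qed.

End Transport.

(** * The isomorphism with the crossed product *)

Section CrossedProductIso.
Context (R : realType) (n : nat) (O : cstarAlgType R) (s : 'I_n -> O).
Hypothesis cuntzO : is_cuntz_algebra s.
Context (g : R[i] -> O -> O).
Hypothesis gaugeO : is_gauge_action s g.
Context (A : cstarAlgType R) (i : A -> O).
Hypothesis fixA : is_gauge_fixed_algebra g i.
Context (E : O -> A).
Hypothesis averageE : is_gauge_average g i E.
Context (F : utfunctor A) (e : forall k : int, F (gline k) -> O) (o : 'I_n).
Arguments e : clear implicits.
Hypothesis gaugeF : is_gauge_functor i (s o) e.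
Context (D : cstarAlgType R) (j : forall k : int, F (gline k) -> D).
Arguments j : clear implicits.
Hypothesis crossedD : is_reduced_crossed_product j.
Context (E' : D -> A).
Hypothesis canonE' : is_rcp_expectation j E'.

Let ih := fix_hom fixA.
Let eZD k := idwZD (gf_ob gaugeF k).
Arguments eZD : clear implicits.
Let jZD k := rcpZD crossedD (k := k).
Arguments jZD : clear implicits.

(* The graph of the isomorphism in degree [k]. *)
Definition rcp_graph (k : int) (y : O) (d : D) : Prop :=
  exists x, e k x = y /\ j k x = d.

(** Transfers identities from [O] to [D]: two elements of [D] related to the same [y] agree. The
    Cuntz relations for the copies of the generators are obtained in this way. *)
Lemma rcp_graph_fun k y d d' : rcp_graph k y d -> rcp_graph k y d' -> d = d'.
Proof. by move=> [x [<- <-]] [x' [/(idw_inj (gf_ob gaugeF k)) -> <-]]. Qed.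

Lemma rcp_graphZD k (c : R[i]) y y' d d' : rcp_graph k y d ->
  rcp_graph k y' d' -> rcp_graph k (c *: y + y') (c *: d + d').
Proof. by move=> [x [<- <-]] [x' [<- <-]]; exists (c *: x + x'); rewrite eZD jZD. Qed.

Lemma rcp_graph0 k : rcp_graph k 0 0.
Proof. by exists 0; rewrite (zd_map0 (eZD k)) (zd_map0 (jZD k)). Qed.

Lemma rcp_graphM k l y y' d d' : rcp_graph k y d -> rcp_graph l y' d' ->
  rcp_graph (k + l) (y * y') (d * d').
Proof.
move=> [x [<- <-]] [x' [<- <-]]; exists (gprod (k + l) x x').
by rewrite (gprodE gaugeF) ?(rcpM crossedD).
Qed.

Lemma rcp_graph_star k y d : rcp_graph k y d -> rcp_graph (- k) (star y) (star d).
Proof.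
move=> [x [<- <-]]; have [x' x'E] := ob_star fixA gaugeF x.
(* The condition [is_gstar] is checked through the injective [e 0], where it reads
   [star (e k x) * e k z = i ⟨x | z⟩]. *)
exists x'; split=> //; rewrite (rcp_star crossedD (y := x'))// => z.
apply: (idw_inj (gf_ob gaugeF 0)).
by rewrite (gprodE gaugeF) ?addNr// x'E (gf_unit gaugeF) (idw_rip (gf_ob gaugeF k)).
Qed.

Lemma rcp_graph_fix a : rcp_graph 0 (i a) (rcp_incl j a).
Proof. by exists (fun0 F a); rewrite (gf_unit gaugeF). Qed.

Lemma rcp_graph1 : rcp_graph 0 1 1.
Proof.
by exists (fun0 F 1); rewrite (gf_unit gaugeF) (star_hom1 ih) (rcp1 crossedD).
Qed.

Lemma rcp_incl_hom : star_hom (rcp_incl j).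
Proof.
have G := rcp_graph_fix.
split=> [c x y|x y||x]; apply: (rcp_graph_fun (G _)).
- by rewrite (star_homZD ih); apply: rcp_graphZD.
- by rewrite (star_homM ih) -[0]addr0; apply: rcp_graphM.
- by rewrite (star_hom1 ih); exact: rcp_graph1.
- by rewrite (star_hom_star ih) -[0]oppr0; apply: rcp_graph_star.
Qed.

Lemma rcp_cuntz_hom : exists f : O -> D,
  star_hom f /\ forall l, rcp_graph 1 (s l) (f (s l)).
Proof.
have [rel univ] := cuntzO.
have [x xE] := choice (graded_gen (ob_range_graded cuntzO gaugeO fixA gaugeF)).
pose t l := j 1 (x l).
have st l : rcp_graph 1 (s l) (t l) by exists (x l).
have [|f [[fh ft] _]] := univ D t; last first.
  by exists f; split=> // l; rewrite ft.
split=> [l m|].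
  apply: (@rcp_graph_fun 0 (star (s l) * s m)).
    by rewrite -(addNr 1); apply: rcp_graphM => //; exact: rcp_graph_star.
  rewrite (cuntz_isom rel); case: (l == m); last exact: rcp_graph0.
  exact: rcp_graph1.
apply: (@rcp_graph_fun 0 1); last exact: rcp_graph1.
rewrite -(cuntz_sum rel); elim/big_ind2: _ => [|y d y' d' yd yd'|l _].
- exact: rcp_graph0.
- by rewrite -[y]scale1r -[d]scale1r; apply: rcp_graphZD.
- by rewrite -(subrr 1); apply: rcp_graphM => //; exact: rcp_graph_star.
Qed.

Lemma rcp_iso : exists f : O -> D, inclusion_iso i E (rcp_incl j) E' f.
Proof.
have [f [fh fs]] := rcp_cuntz_hom.
pose S k y := rcp_graph k y (f y).
have gS : graded_family s S.
  split=> [k c x y xk yk|k l x y xk yl|k x xk||//].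
  - by rewrite /S (star_homZD fh); apply: rcp_graphZD.
  - by rewrite /S (star_homM fh); apply: rcp_graphM.
  - by rewrite /S (star_hom_star fh); apply: rcp_graph_star.
  - by rewrite /S (star_hom1 fh); exact: rcp_graph1.
have Ec := expectation_continuous gaugeO fixA averageE.
have fc := star_hom_continuous fh.
have fi a : f (i a) = rcp_incl j a.
  (* Writing [a] as [E (i a)] and generalizing [i a] to any [y] in [O] makes [graded_total]
     applicable; in nonzero degrees both sides vanish. *)
  rewrite -[a](expectation_fix fixA averageE); move: (i a) => y.
  move: y; apply: (graded_total cuntzO gS).
    split=> [||x y xP yP].
    - apply: closed_eq.
        by apply: comp_continuous fc (comp_continuous (star_hom_continuous ih) Ec).
      exact: comp_continuous (star_hom_continuous rcp_incl_hom) Ec.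
    - by rewrite (expectation0 gaugeO fixA averageE) (star_hom0 ih) (star_hom0 fh)
        (star_hom0 rcp_incl_hom).
    - by rewrite (expectationD gaugeO fixA averageE) (star_homD ih) (star_homD fh)
        (star_homD rcp_incl_hom) xP yP.
  move=> k _ [x [<- fx]]; have [k0|k0] := eqVneq k 0; last first.
    by rewrite (expectation_ob gaugeO fixA averageE gaugeF)// (star_hom0 ih)
      (star_hom0 fh) (star_hom0 rcp_incl_hom).
  subst k; have [b xb] := ob_fun0 x; subst x.
  rewrite (gf_unit gaugeF) (expectation_fix fixA averageE) in fx *.
  by rewrite -fx.
have fe k x : f (e k x) = j k x.
  (* [fi] places [A] in [S 0], so [S k] contains the whole spectral bimodule. *)
  have [x' [xx' <-]] : S k (e k x).
    apply: (graded_spectral gS _ (ob_spectral gaugeF x)) => a.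
    by rewrite /S fi; exact: rcp_graph_fix.
  by rewrite (idw_inj (gf_ob gaugeF k) xx').
have fz (x : zfam F) : finsupp x -> f (zembed e x) = zembed j x.
  move=> /finsuppP[K xK]; rewrite (zembedE eZD xK) (zembedE jZD xK).
  by rewrite (star_hom_sum fh); apply: eq_bigr => k _.
have E'c : cnorm_continuous E'.
  move=> d eps eps0; have [h h0 hP] := canonE'.1 d eps eps0.
  by exists h => // d' dd'; rewrite cnormC; apply: hP; rewrite cnormC.
have fE y : E' (f y) = E y.
  have cl : cnorm_closed (fun y => E' (f y) = E y).
    by apply: closed_eq => //; exact: comp_continuous.
  apply: cl => eps /(zembed_dense cuntzO gaugeO fixA gaugeF y)[x [xf yx]].
  exists (zembed e x) => //; rewrite fz//.
  apply: (bij_inj (fun0_bij F)); rewrite canonE'.2//.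
  by rewrite (expectation_zembed gaugeO fixA averageE gaugeF).
have finj : injective f.
  move=> x y xy; apply/eqP; rewrite -subr_eq0; apply/eqP.
  apply: (expectation_faithful cuntzO gaugeO fixA averageE).
  rewrite -fE (star_homM fh) (star_homB fh) xy subrr mulr0.
  by rewrite -(star_hom0 fh) fE (expectation0 gaugeO fixA averageE).
have fn := star_hom_isometric fh finj.
have fsurj d : exists y, f y = d.
  have app m : exists y, cnorm (f y - d) < m.+1%:R^-1.
    have m0 : 0 < m.+1%:R^-1 :> R by rewrite invr_gt0 ltr0n.
    have [_ [x xf <-] dx] := rcp_dense crossedD d m0.
    by exists (zembed e x); rewrite fz// cnormC.
  have [u uP] := choice app.
  have fu : cvg_cnorm (fun m => f (u m)) d.
    move=> eps eps0; exists (Num.truncn eps^-1) => m Mm.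
    rewrite (lt_le_trans (uP m))// invf_ple ?posrE ?ltr0n//.
    by rewrite (le_trans (ltW (truncnS_gt _)))// ler_nat.
  have [y uy] : exists y, cvg_cnorm u y.
    apply: (@cnorm_complete R O) => eps eps0.
    have [M Mu] := fu _ (divr_gt0 eps0 (ltr0n R 2)).
    exists M => p q Mp Mq; rewrite -fn (star_homB fh).
    rewrite (le_lt_trans (cnorm_tri _ d _))// [eps]splitr ltrD ?Mu//.
    by rewrite cnormC Mu.
  exists y; apply: (@cvg_cnorm_uniq _ _ (fun m => f (u m))) => // eps /uy[M Mu].
  by exists M => p /Mu; rewrite -(star_homB fh) fn.
exists f; split=> //; split=> //.
have [h hK] := choice fsurj.
by exists h => // y; apply: finj; rewrite hK.
Qed.

End CrossedProductIso.

Theorem corollary3p10 (R : realType) (n : nat) (n_ge2 : (2 <= n)%N)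
  (O : cstarAlgType R) (s : 'I_n -> O) (cuntzO : is_cuntz_algebra s)
  (g : R[i] -> O -> O) (gaugeO : is_gauge_action s g)
  (A : cstarAlgType R) (i : A -> O) (fixA : is_gauge_fixed_algebra g i)
  (E : O -> A) (averageE : is_gauge_average g i E)
  (F : utfunctor A) (ffF : fully_faithful F)
  (e : forall k : int, F (gline k) -> O)
  (gaugeF : is_gauge_functor i (s (Ordinal (ltnW n_ge2))) e)
  (D : cstarAlgType R) (j : forall k : int, F (gline k) -> D)
  (crossedD : is_reduced_crossed_product j)
  (E' : D -> A) (canonE' : is_rcp_expectation j E') :
  [/\ irreducible_cdiscrete i E,
      irreducible_cdiscrete (rcp_incl j) E' &
      exists f : O -> D, inclusion_iso i E (rcp_incl j) E' f].
Proof.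
have irrO := cuntz_irreducible_cdiscrete cuntzO gaugeO fixA averageE gaugeF ffF.
have [f fiso] := rcp_iso cuntzO gaugeO fixA averageE gaugeF crossedD canonE'.
split=> //; last by exists f.
exact: irreducible_cdiscrete_iso fiso irrO.
Qed.
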